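(* A Finsler manifold $(M,L)$ is $P$-symmetric if, and only if, the $v$-curvature tensor $S$ of its Cartan connection $\nabla$ satisfies the equation $\nabla_{\beta\overline{\eta}}S=0$.
   Context: Setting. $M$ is a smooth manifold of finite dimension $n$, $\pi:\mathcal{T}M\to M$ is the bundle of nonzero tangent vectors, $\pi^{-1}(TM)\to\mathcal{T}M$ is the pullback of $TM$ by $\pi$, and $\mathfrak{X}(\pi(M))$ is the module of its smooth sections ($\pi$-vector fields, written $\overline{X}$). $\overline{\eta}(u)=(u,u)$ is the fundamental $\pi$-vector field. $\rho:T(\mathcal{T}M)\to\pi^{-1}(TM)$ is $\rho=(\pi_{\mathcal{T}M},d\pi)$ and $\gamma:\pi^{-1}(TM)\to V(\mathcal{T}M)$ is the natural isomorphism (vertical lift) onto the vertical bundle. $(M,L)$ is a Finsler manifold ($L$ positively homogeneous of degree $1$, smooth on $\mathcal{T}M$, with positive definite metric $g$ on $\pi^{-1}(TM)$ of components $g_{ij}=\frac12\partial^2L^2/\partial y^i\partial y^j$). A linear connection $\nabla$ in $\pi^{-1}(TM)$ is regular if, with $K(X)=\nabla_X\overline{\eta}$ and $H(\mathcal{T}M)=\ker K$, one has $T(\mathcal{T}M)=V(\mathcal{T}M)\oplus H(\mathcal{T}M)$; then $\beta=(\rho|_{H(\mathcal{T}M)})^{-1}$. Its torsion is $\mathbf{T}(X,Y)=\nabla_X\rho Y-\nabla_Y\rho X-\rho[X,Y]$; put $Q(\overline{X},\overline{Y})=\mathbf{T}(\beta\overline{X},\beta\overline{Y})$ and $T(\overline{X},\overline{Y})=\mathbf{T}(\gamma\overline{X},\beta\overline{Y})$.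 Throughout, $\nabla$ is the Cartan connection: the unique regular connection with $\nabla g=0$, $Q=0$ and $g(T(\overline{X},\overline{Y}),\overline{Z})=g(T(\overline{X},\overline{Z}),\overline{Y})$. Its classical curvature is $\mathbf{K}(X,Y)\rho Z=-\nabla_X\nabla_Y\rho Z+\nabla_Y\nabla_X\rho Z+\nabla_{[X,Y]}\rho Z$; the mixed ($hv$-) and vertical ($v$-) curvature tensors are $P(\overline{X},\overline{Y})\overline{Z}=\mathbf{K}(\beta\overline{X},\gamma\overline{Y})\overline{Z}$ and $S(\overline{X},\overline{Y})\overline{Z}=\mathbf{K}(\gamma\overline{X},\gamma\overline{Y})\overline{Z}$. Definition. $(M,L)$ is $P$-symmetric if $P(\overline{X},\overline{Y})\overline{Z}=P(\overline{Y},\overline{X})\overline{Z}$ for all $\overline{X},\overline{Y},\overline{Z}\in\mathfrak{X}(\pi(M))$. *)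

(* Defs.v *)
From mathcomp Require Import all_boot all_order all_algebra.
From mathcomp Require Import all_classical all_reals all_analysis.
Set Implicit Arguments.
Unset Strict Implicit.
Unset Printing Implicit Defensive.
Import Order.TTheory GRing.Theory Num.Theory.
Import numFieldNormedType.Exports.
Local Open Scope classical_set_scope.
Local Open Scope ring_scope.

(* MathComp-Analysis has no manifolds.  The encoding below is the one of
   Lean's mathlib: every point p has a preferred chart [chart_at p], and the
   tangent space at p is a copy of R^n, a vector being given by its components
   in the preferred chart at p.  Components in the other charts are obtained
   by differentiating the transition maps (see [tcoord]). *)

Fixpoint Cr (R : realType) (m : nat) (V : normedModType R) (r : nat)
    (U : set 'rV[R]_m) (f : 'rV[R]_m -> V) : Prop :=
  match r with
  | 0 => forall x, U x -> {for x, continuous f}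
  | s.+1 => (forall x, U x -> differentiable f x) /\
            (forall v, Cr s U ('D_v f))
  end.

(* Meaningful for open U. *)
Definition Cinfty (R : realType) (m : nat) (V : normedModType R)
    (U : set 'rV[R]_m) (f : 'rV[R]_m -> V) : Prop :=
  forall r, Cr r U f.

Record atlas (R : realType) (m : nat) (N : Type) := Atlas {
  chart : Type;
  cdom : chart -> set N;
  cmap : chart -> N -> 'rV[R]_m;
  chart_at : N -> chart }.

Section Atlas.
Variables (R : realType) (m : nat) (N : Type) (A : atlas R m N).

(* f \o phi_i^-1 on phi_i(U_i), and 0 elsewhere. *)
Definition localrep (V : normedModType R) (i : chart A) (f : N -> V) :
    'rV[R]_m -> V :=
  fun x => xget 0 [set f p | p in [set p | cdom i p /\ cmap i p = x]].

Definition smooth (V : normedModType R) (f : N -> V) : Prop :=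
  forall i : chart A, Cinfty (cmap i @` cdom i) (localrep i f).

(* Components in the chart i of the tangent vector v at p. *)
Definition tcoord (i : chart A) (p : N) (v : 'rV[R]_m) : 'rV[R]_m :=
  'd (localrep (chart_at A p) (cmap i)) (cmap (chart_at A p) p) v.

Definition smooth_field (X : N -> 'rV[R]_m) : Prop :=
  forall i : chart A,
    Cinfty (cmap i @` cdom i) (localrep i (fun p => tcoord i p (X p))).

(* The derivative X f of a function along a vector field. *)
Definition fderiv (V : normedModType R) (X : N -> 'rV[R]_m) (f : N -> V) :
    N -> V :=
  fun p => 'd (localrep (chart_at A p) f) (cmap (chart_at A p) p) (X p).

(* [X, Y]^k = X (Y^k) - Y (X^k), computed in the preferred chart at p. *)
Definition lie (X Y : N -> 'rV[R]_m) : N -> 'rV[R]_m :=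
  fun p => let i := chart_at A p in
    fderiv X (fun q => tcoord i q (Y q)) p
    - fderiv Y (fun q => tcoord i q (X q)) p.

Definition subatlas (P : pred N) : atlas R m {p : N | P p} :=
  @Atlas R m {p : N | P p} (chart A) (fun i => [set p | cdom i (sval p)])
    (fun i p => cmap i (sval p)) (fun p => chart_at A (sval p)).

End Atlas.

Record smooth_manifold (R : realType) (m : nat) (M : topologicalType)
    (A : atlas R m M) : Prop := SmoothManifold {
  manifold_hausdorff : hausdorff_space M;
  manifold_second_countable : @second_countable M;
  manifold_chart_at : forall p, cdom (chart_at A p) p;
  manifold_open_dom : forall i : chart A, open (cdom i);
  manifold_inj : forall (i : chart A) p q,
    cdom i p -> cdom i q -> cmap i p = cmap i q -> p = q;
  manifold_continuous : forall (i : chart A) p,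
    cdom i p -> {for p, continuous (cmap i)};
  manifold_open_map : forall (i : chart A) (W : set M),
    W `<=` cdom i -> open W -> open (cmap i @` W);
  manifold_transition : forall i j : chart A,
    Cinfty (cmap i @` (cdom i `&` cdom j)) (localrep i (cmap j)) }.

(* The differential of f : N -> N' at p. *)
Definition mdiff (R : realType) (m k : nat) (N N' : Type)
    (A : atlas R m N) (B : atlas R k N') (f : N -> N') (p : N)
    (v : 'rV[R]_m) : 'rV[R]_k :=
  'd (localrep (chart_at A p) (fun q => cmap (chart_at B (f p)) (f q)))
     (cmap (chart_at A p) p) v.

Section TangentBundle.
Variables (R : realType) (n : nat) (M : Type) (A : atlas R n M).

(* TM as the set of pairs (p, v), with v given in the preferred chart at p;
   the charts are the induced ones, with coordinates (x, y). *)
Definition tangent_atlas : atlas R (n + n) (M * 'rV[R]_n) :=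
  @Atlas R (n + n) (M * 'rV[R]_n) (chart A) (fun i => [set u | cdom i u.1])
    (fun i u => row_mx (cmap i u.1) (tcoord i u.1 u.2))
    (fun u => chart_at A u.1).

(* The bundle of nonzero tangent vectors. *)
Definition slit : Type := {u : M * 'rV[R]_n | u.2 != 0}.

Definition slit_atlas : atlas R (n + n) slit :=
  subatlas tangent_atlas (fun u => u.2 != 0).

Definition foot (u : slit) : M := (sval u).1.

(* Also the fundamental pi-vector field. *)
Definition eta (u : slit) : 'rV[R]_n := (sval u).2.

(* Vector fields on [slit]; pi-vector fields, that is sections of the pullback
   of TM, whose value at u is a tangent vector at [foot u].  Smoothness is the
   predicate [smooth_field slit_atlas], respectively [smooth_pifield]. *)
Definition vfield : Type := slit -> 'rV[R]_(n + n).
Definition pifield : Type := slit -> 'rV[R]_n.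

Definition smooth_pifield (X : pifield) : Prop :=
  forall i : chart slit_atlas,
    Cinfty (cmap i @` cdom i)
      (localrep i (fun u : slit => @tcoord R n M A i (foot u) (X u))).

Definition dpi (u : slit) : 'rV[R]_(n + n) -> 'rV[R]_n :=
  mdiff slit_atlas A foot u.

Definition rho (X : vfield) : pifield := fun u => dpi u (X u).

(* The velocity at t = 0 of the curve t |-> u + t X(u) in a fibre of TM. *)
Definition gamma (X : pifield) : vfield := fun u =>
  derive1 (fun t : R => @cmap _ _ _ tangent_atlas
                          (chart_at tangent_atlas (sval u))
                          (foot u, eta u + t *: X u)) 0.

(* g_u(v, w), the second derivative of L^2/2 along the fibre of u in the
   directions v and w: its components are g_ij. *)
Definition metric (L : M * 'rV[R]_n -> R) (u : slit) (v w : 'rV[R]_n) : R :=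
  2^-1 * derive1 (fun s : R => derive1 (fun t : R =>
           L (foot u, eta u + s *: v + t *: w) ^+ 2) 0) 0.

Record finsler (L : M * 'rV[R]_n -> R) : Prop := Finsler {
  finsler_homogeneous : forall p v (l : R), 0 < l -> L (p, l *: v) = l * L (p, v);
  finsler_smooth : smooth slit_atlas (fun u : slit => L (sval u));
  finsler_posdef : forall u w, w != 0 -> 0 < metric L u w w }.

Section Connection.
(* Only the values of D on smooth fields are relevant. *)
Variable D : vfield -> pifield -> pifield.

Record linear_connection : Prop := LinearConnection {
  connection_smooth : forall X Y,
    smooth_field slit_atlas X -> smooth_pifield Y -> smooth_pifield (D X Y);
  connection_addl : forall X X' Y,
    smooth_field slit_atlas X -> smooth_field slit_atlas X' ->
    smooth_pifield Y -> D (X \+ X') Y = D X Y \+ D X' Y;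
  connection_scalel : forall (f : slit -> R) X Y,
    smooth slit_atlas f -> smooth_field slit_atlas X -> smooth_pifield Y ->
    D (fun u => f u *: X u) Y = fun u => f u *: D X Y u;
  connection_addr : forall X Y Y',
    smooth_field slit_atlas X -> smooth_pifield Y -> smooth_pifield Y' ->
    D X (Y \+ Y') = D X Y \+ D X Y';
  connection_leibniz : forall (f : slit -> R) X Y,
    smooth slit_atlas f -> smooth_field slit_atlas X -> smooth_pifield Y ->
    D X (fun u => f u *: Y u) =
      fun u => fderiv slit_atlas X f u *: Y u + f u *: D X Y u }.

Definition Kmap (X : vfield) : pifield := D X eta.

Definition vertical (u : slit) : set 'rV[R]_(n + n) :=
  [set w | dpi u w = 0].

Definition horizontal (u : slit) : set 'rV[R]_(n + n) :=
  [set w | exists X, [/\ smooth_field slit_atlas X, X u = w & Kmap X u = 0]].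

Definition regular : Prop := forall u,
  (forall w, exists v h, [/\ vertical u v, horizontal u h & w = v + h]) /\
  vertical u `&` horizontal u = [set 0].

Definition beta (X : pifield) : vfield := fun u =>
  xget 0 [set w | horizontal u w /\ dpi u w = X u].

Definition torsion (X Y : vfield) : pifield := fun u =>
  D X (rho Y) u - D Y (rho X) u - rho (lie slit_atlas X Y) u.

Definition Qtorsion (X Y : pifield) : pifield := torsion (beta X) (beta Y).
Definition Ttorsion (X Y : pifield) : pifield := torsion (gamma X) (beta Y).

Definition curvature (X Y : vfield) (Z : pifield) : pifield := fun u =>
  - D X (D Y Z) u + D Y (D X Z) u + D (lie slit_atlas X Y) Z u.

Definition Pcurv (X Y Z : pifield) : pifield :=
  curvature (beta X) (gamma Y) Z.
Definition Scurv (X Y Z : pifield) : pifield :=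
  curvature (gamma X) (gamma Y) Z.

Definition covder (W : vfield) (C : pifield -> pifield -> pifield -> pifield)
    (X Y Z : pifield) : pifield := fun u =>
  D W (C X Y Z) u - C (D W X) Y Z u - C X (D W Y) Z u - C X Y (D W Z) u.

Record cartan_connection (L : M * 'rV[R]_n -> R) : Prop := CartanConnection {
  cartan_linear : linear_connection;
  cartan_regular : regular;
  cartan_metric : forall X Y Z,
    smooth_field slit_atlas X -> smooth_pifield Y -> smooth_pifield Z ->
    forall u, fderiv slit_atlas X (fun u' => metric L u' (Y u') (Z u')) u =
      metric L u (D X Y u) (Z u) + metric L u (Y u) (D X Z u);
  cartan_Q : forall X Y, smooth_pifield X -> smooth_pifield Y ->
    forall u, Qtorsion X Y u = 0;
  cartan_T : forall X Y Z,
    smooth_pifield X -> smooth_pifield Y -> smooth_pifield Z ->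
    forall u, metric L u (Ttorsion X Y u) (Z u) =
              metric L u (Ttorsion X Z u) (Y u) }.

Definition P_symmetric : Prop := forall X Y Z,
  smooth_pifield X -> smooth_pifield Y -> smooth_pifield Z ->
  forall u, Pcurv X Y Z u = Pcurv Y X Z u.

End Connection.
End TangentBundle.

(* Main.v *)
(* Write G = beta eta.  The differential Bianchi identity for G, gamma U, gamma V
   reads
     (nabla_G S)(U, V) = P(V, U) - P(U, V),
   because [G, gamma U] = gamma (nabla_G U) - beta U and P(eta, .) = 0; the theorem
   follows at once.  To see that P(eta, U) = 0, note that g(P(eta, U)Z, W) is skew
   in Z and W since nabla is metric, and symmetric by the algebraic Bianchi
   identity: P(eta, U)Z - P(Z, U)eta is expressed by T and nabla_G T, which are
   g-symmetric, and Z |-> P(Z, U)eta is g-symmetric because T(., eta) = 0.  The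
   latter is Euler's relation for the energy E = L^2/2, in the form
   g(eta, Z) = (gamma Z)E.

   Only the additive structure of the modules of smooth fields enters these
   identities.  The analytic input is the Jacobi identity on the slit tangent
   bundle, the smoothness of beta and the tensoriality of nabla. *)
From HB Require Import structures.
Require Import Defs.
From mathcomp Require Import all_boot all_order all_algebra.
From mathcomp Require Import all_classical all_reals all_analysis.
From mathcomp Require Import ring lra.
Set Implicit Arguments.
Unset Strict Implicit.
Unset Printing Implicit Defensive.
Import Order.TTheory GRing.Theory Num.Theory.
Import numFieldNormedType.Exports.
Local Open Scope classical_set_scope.
Local Open Scope ring_scope.

(** Two features of the encoding shape the analytic part. Vectors are stored in the preferred chart
    of their base point, so [lie] changes chart from point to point and even its smoothness rests on
    chart independence. And [D] is constrained on smooth global fields only, while [beta] is a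
    pointwise choice: no identity can be applied to [beta Z] before its smoothness is known. The way
    out is that a horizontal vector is by definition the value of a global smooth field. Lifting a
    basis at [u] gives such fields; the Gram matrix of their projections and Cramer's rule then
    expand a smooth multiple of any pi-vector field, the factor being nonzero at [u]. Tensoriality
    and the smoothness of [beta] both come from this expansion. On the algebraic side, homogeneity
    enters through [ca_euler], which does not mention [D]. Compared with the metric condition it
    gives [T(_, eta) = 0], hence that [nabla_(gamma U) eta] is [U]. So [X |-> nabla_X eta] inverts
    the vertical lift, and every field splits into explicit vertical and horizontal parts; this is
    what makes the brackets in the Bianchi identities computable. *)

(** * Locality of the differential *)

Section Germs.
Variables (R : realType) (V W : normedModType R).

(** The remainder of the expansion with zero linear part is identically zero near [x]. Adding
    [g - f] then carries differentiability from [f] to any [g] with the same germ. *)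
Lemma is_diff_near0 (h : V -> W) x : (\forall y \near x, h y = 0) ->
  is_diff x h (\0 : {linear V -> W}).
Proof.
move=> h0; have hx := nbhs_singleton h0.
have c0 : continuous (\0 : {linear V -> W}) by move=> y; exact: cst_continuous.
have o0 : h \o shift x = cst (h x) + (\0 : {linear V -> W}) +o_ 0 id.
  apply/eqaddoP => _/posnumP[e].
  have : \forall y \near (0 : V), h (y + x) = 0.
    by move: h0; rewrite (near_shift 0) /=; apply: filterS => y; rewrite subr0.
  apply: filterS => y hy; rewrite !fctE /= hy hx addr0 subrr normr0.
  by rewrite mulr_ge0.
have dE := diff_unique c0 o0.
apply: DiffDef; last by rewrite dE.
by apply/diff_locallyP; split; [rewrite dE | rewrite dE].
Qed.

Lemma differentiable_near (f g : V -> W) x :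
  (\forall y \near x, f y = g y) -> differentiable f x -> differentiable g x.
Proof.
move=> fg df; have -> : g = f + (g - f) by rewrite addrC subrK.
apply: differentiableD => //.
suff /is_diff_near0[] : \forall y \near x, (g - f) y = 0 by [].
by apply: filterS fg => y /= e; rewrite !fctE e subrr.
Qed.

Lemma diff_near (f g : V -> W) x : (\forall y \near x, f y = g y) ->
  differentiable f x -> 'd f x = 'd g x :> (V -> W).
Proof.
move=> fg df; have dg := differentiable_near fg df.
by apply/funext => v; rewrite -!deriveE //; exact: near_eq_derive.
Qed.

Lemma diff_near_app (f g : V -> W) x v : (\forall y \near x, f y = g y) ->
  differentiable f x -> 'd f x v = 'd g x v.
Proof. by move=> fg df; rewrite (diff_near fg df). Qed.
End Germs.

(** * Calculus of [Cr] maps on open sets, up to Schwarz's theorem *)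

Section Smoothness.
Variable R : realType.

Lemma Cr_ext m (V : normedModType R) r (U : set 'rV[R]_m) (f g : 'rV[R]_m -> V) :
  open U -> (forall x, U x -> f x = g x) -> Cr r U f -> Cr r U g.
Proof.
move=> oU; elim: r f g => [|r IH] f g fg /=.
  move=> cf x Ux; have cfx : f @ x --> f x := cf x Ux.
  change (g @ x --> g x); rewrite -(fg _ Ux); apply: cvg_trans cfx.
  apply: (@near_eq_cvg _ _ (nbhs x)); near=> y; apply: fg; near: y.
  exact: open_nbhs_nbhs.
have fgn x : U x -> \forall y \near x, f y = g y.
  by move=> Ux; near=> y; apply: fg; near: y; exact: open_nbhs_nbhs.
case=> df cf; split=> [x Ux|v].
  exact: differentiable_near (fgn _ Ux) (df _ Ux).
by apply: (IH ('D_v f)) => // x Ux; exact/near_eq_derive/fgn.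
Unshelve. all: by end_near. Qed.

Lemma Cr_sub m (V : normedModType R) r (U U' : set 'rV[R]_m) (f : 'rV[R]_m -> V) :
  U' `<=` U -> Cr r U f -> Cr r U' f.
Proof.
move=> sU; elim: r f => [|r IH] f /= => [cf x /sU|[df cf]]; first exact: cf.
by split=> [x /sU/df//|v]; exact: IH.
Qed.

Lemma Cr_local m (V : normedModType R) r (U : set 'rV[R]_m) (f : 'rV[R]_m -> V) :
  (forall x, U x -> exists2 U', U' x & Cr r U' f) -> Cr r U f.
Proof.
elim: r f => [|r IH] f /= h => [x /h[U' U'x]|]; first exact.
split=> [x /h[U' U'x []]|v]; first by move=> + _; exact.
by apply: IH => x /h[U' U'x [_ /(_ v)]]; exists U'.
Qed.

Lemma Cr_le m (V : normedModType R) r (U : set 'rV[R]_m) (f : 'rV[R]_m -> V) :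
  Cr r.+1 U f -> Cr r U f.
Proof.
elim: r f => [|r IH] f [df cf]; last by split=> // v; exact: IH.
by move=> x Ux; apply: differentiable_continuous; exact: df.
Qed.

Lemma Cr_cst m (V : normedModType R) r (U : set 'rV[R]_m) (a : V) :
  Cr r U (cst a).
Proof.
elim: r a => [|r IH] a /=; first by move=> x _; exact: cst_continuous.
split=> [x _|v]; first exact: differentiable_cst.
rewrite (_ : 'D_v _ = cst 0); first exact: IH.
by apply/funext => x; rewrite derive_cst.
Qed.

Lemma Cr_linear m (V : normedModType R) r (U : set 'rV[R]_m)
  (f : {linear 'rV[R]_m -> V}) : continuous f -> Cr r U f.
Proof.
move=> cf; case: r => [|r] /=; first by move=> x _; exact: cf.
split=> [x _|v]; first exact: linear_differentiable.
rewrite (_ : 'D_v _ = cst (f v)); first exact: Cr_cst.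
apply/funext => x; rewrite deriveE; last exact: linear_differentiable.
by rewrite diff_lin.
Qed.

Lemma Cr_add m (V : normedModType R) r (U : set 'rV[R]_m) (f g : 'rV[R]_m -> V) :
  open U -> Cr r U f -> Cr r U g -> Cr r U (fun x => f x + g x).
Proof.
move=> oU; elim: r f g => [|r IH] f g /=.
  by move=> cf cg x Ux; exact: continuousD (cf x Ux) (cg x Ux).
case=> df cf [dg cg]; split=> [x Ux|v].
  by apply: differentiableD; [exact: df|exact: dg].
apply: (Cr_ext oU _ (IH _ _ (cf v) (cg v))) => x Ux.
by rewrite -deriveD //; apply: diff_derivable; [exact: df|exact: dg].
Qed.

Lemma Cr_mul m r (U : set 'rV[R]_m) (f g : 'rV[R]_m -> R) :
  open U -> Cr r U f -> Cr r U g -> Cr r U (fun x => f x * g x).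
Proof.
move=> oU; elim: r f g => [|r IH] f g.
  by move=> cf cg x Ux; exact: continuousM (cf x Ux) (cg x Ux).
move=> cf' cg'; have [df cf] := cf'; have [dg cg] := cg'.
split=> [x Ux|v].
  by apply: differentiableM; [exact: df|exact: dg].
have h : Cr r U (fun x => f x * 'D_v g x + g x * 'D_v f x).
  by apply: Cr_add => //; apply: IH => //; (exact: Cr_le || exact: cf || exact: cg).
apply: (Cr_ext oU _ h) => x Ux.
exact/esym/(deriveM (diff_derivable (df _ Ux)) (diff_derivable (dg _ Ux))).
Qed.

(** The derivative of [1/f] is [-(1/f)^2] times that of [f]: it involves [1/f] itself at one order
    less, so the induction on [r] closes. *)
Lemma Cr_inv m r (U : set 'rV[R]_m) (f : 'rV[R]_m -> R) :
  open U -> (forall x, U x -> f x != 0) ->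
  Cr r U f -> Cr r U (fun x => (f x)^-1).
Proof.
move=> oU f0; elim: r => [|r IH] /=.
  by move=> cf x Ux; exact: (continuousV (f0 x Ux) (cf x Ux)).
move=> cf'; have [df cf] := cf'; split=> [x Ux|v].
  by apply: differentiableV; [exact: df|exact: (f0 x Ux)].
have h : Cr r U (fun x => (-1) * ((f x)^-1 * (f x)^-1) * 'D_v f x).
  by apply: Cr_mul => //; apply: Cr_mul => //; [exact: Cr_cst|
    apply: Cr_mul => //; apply: IH; exact: Cr_le].
apply: (Cr_ext oU _ h) => x Ux.
rewrite [RHS](deriveV (f0 _ Ux) (diff_derivable (df _ Ux))) scaleNr.
by rewrite mulN1r mulNr -invfM -expr2.
Qed.

Lemma Cr_sum m (I : Type) (s : seq I) r (U : set 'rV[R]_m)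
  (V : normedModType R) (f : I -> 'rV[R]_m -> V) :
  open U -> (forall i, Cr r U (f i)) -> Cr r U (fun x => \sum_(i <- s) f i x).
Proof.
move=> oU cf; elim: s => [|i s IH].
  by apply: (Cr_ext oU _ (Cr_cst r U 0)) => x _; rewrite big_nil.
by apply: (Cr_ext oU _ (Cr_add oU (cf i) IH)) => x _; rewrite big_cons.
Qed.

Lemma differentiable_coordP (V : normedModType R) k (f : V -> 'rV[R]_k) x :
  differentiable f x <-> forall i, differentiable (fun y => f y 0 i) x.
Proof.
split=> [df i|df].
  exact: (differentiable_comp df (differentiable_coord (f x) 0 i)).
have {1}-> : f = \sum_(i < k) (fun y => f y 0 i *: delta_mx 0 i).
  by apply/funext => y; rewrite fct_sumE {1}[f y]row_sum_delta.
by apply: differentiable_sum => i; exact: differentiableZl.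
Qed.

Lemma diff_coord (V : normedModType R) k (f : V -> 'rV[R]_k) x v i :
  differentiable f x -> 'd f x v 0 i = 'd (fun y => f y 0 i) x v.
Proof.
move=> df; have dfi := (differentiable_coordP f x).1 df i.
by rewrite -!deriveE // derive_mx ?mxE //; exact: diff_derivable.
Qed.

Lemma Cr_coordP m k r (U : set 'rV[R]_m) (f : 'rV[R]_m -> 'rV[R]_k) :
  open U -> Cr r U f <-> forall i, Cr r U (fun x => f x 0 i).
Proof.
move=> oU; split; elim: r f => [|r IH] f.
- move=> cf i x Ux; apply: (@continuous_comp _ _ _ f (fun M => M 0 i)).
    exact: cf.
  exact: coord_continuous.
- move=> [df cf] i; split=> [x Ux|v]; first exact: (differentiable_coordP f x).1 (df _ Ux) i.
  apply: (Cr_ext oU _ (IH _ (cf v) i)) => x Ux.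
  have dfi := (differentiable_coordP f x).1 (df _ Ux) i.
  by rewrite !deriveE ?diff_coord //; exact: df.
- move=> cf.
  have h : Cr 0 U (fun y => \sum_(i < k) f y 0 i *: delta_mx 0 i : 'rV[R]_k).
    by apply: Cr_sum => // i x Ux; exact: continuousZr_tmp (cf i x Ux).
  by apply: (Cr_ext oU _ h) => x _; rewrite -row_sum_delta.
- move=> cf; have df x : U x -> differentiable f x.
    by move=> Ux; apply/differentiable_coordP => i; have [/(_ x Ux)] := cf i.
  split=> [x Ux|v]; first exact: df.
  apply: IH => i; have [_ /(_ v) cfi] := cf i.
  apply: (Cr_ext oU _ cfi) => x Ux.
  have dfi := (differentiable_coordP f x).1 (df _ Ux) i.
  by rewrite !deriveE ?diff_coord //; exact: df.
Qed.

Lemma diff_sum_coord m (V : normedModType R) (f : 'rV[R]_m -> V) x v :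
  'd f x v = \sum_(i < m) v 0 i *: 'd f x (delta_mx 0 i).
Proof.
rewrite {1}[v]row_sum_delta linear_sum; apply: eq_bigr => i _.
by rewrite linearZ.
Qed.

Lemma Cr_coord m r (U : set 'rV[R]_m) i : Cr r U (fun x => x 0 i).
Proof.
pose f := fun x : 'rV[R]_m => x 0 i.
have lf : linear f by move=> a x y; rewrite /f !mxE.
pose fL : {linear 'rV[R]_m -> R} := HB.pack f (GRing.isLinear.Build _ _ _ _ _ lf).
exact: (@Cr_linear _ _ r U fL (@coord_continuous _ _ _ _ _)).
Qed.

(** In coordinates the chain rule is a sum of products of components of ['D_v g] with partial
    derivatives of [f] composed with [g]. The latter are again composites, one order lower, to which
    the induction hypothesis applies because [f] is generalised. *)
Lemma Cr_comp m k r (U : set 'rV[R]_m) (U' : set 'rV[R]_k)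
  (f : 'rV[R]_k -> R) (g : 'rV[R]_m -> 'rV[R]_k) :
  open U -> (forall x, U x -> U' (g x)) -> Cr r U' f -> Cr r U g ->
  Cr r U (fun x => f (g x)).
Proof.
move=> oU gU; elim: r f => [|r IH] f.
  move=> cf cg x Ux; apply: (@continuous_comp _ _ _ g f); first exact: cg.
  exact: (cf _ (gU _ Ux)).
move=> [df cf] cg'; have [dg cg] := cg'; split=> [x Ux|v].
  exact: (differentiable_comp (dg _ Ux) (df _ (gU _ Ux))).
have h : Cr r U (fun x => \sum_(i < k) 'D_v g x 0 i * 'D_(delta_mx 0 i) f (g x)).
  apply: Cr_sum => // i; apply: Cr_mul => //.
    exact: ((Cr_coordP r ('D_v g) oU).1 (cg v) i).
  exact: (IH _ (cf _) (Cr_le cg')).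
apply: (Cr_ext oU _ h) => x Ux; have dfx := df _ (gU _ Ux).
rewrite [RHS]deriveE; last exact: (differentiable_comp (dg _ Ux) dfx).
rewrite (diff_comp (dg _ Ux) dfx) /= diff_sum_coord.
apply: eq_bigr => i _; rewrite !deriveE //; exact: dg.
Qed.

Lemma Cr_comp_row m k l r (U : set 'rV[R]_m) (U' : set 'rV[R]_k)
  (f : 'rV[R]_k -> 'rV[R]_l) (g : 'rV[R]_m -> 'rV[R]_k) :
  open U -> open U' -> (forall x, U x -> U' (g x)) -> Cr r U' f -> Cr r U g ->
  Cr r U (fun x => f (g x)).
Proof.
move=> oU oU' gU cf cg; apply/(Cr_coordP _ _ oU) => i.
exact: (Cr_comp oU gU ((Cr_coordP r f oU').1 cf i) cg).
Qed.

Lemma Cr_diff m r (U : set 'rV[R]_m) (f : 'rV[R]_m -> R)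
  (g : 'rV[R]_m -> 'rV[R]_m) :
  open U -> Cr r.+1 U f -> Cr r U g -> Cr r U (fun x => 'd f x (g x)).
Proof.
move=> oU [df cf] cg.
have h : Cr r U (fun x => \sum_(i < m) g x 0 i * 'D_(delta_mx 0 i) f x).
  apply: Cr_sum => // i; apply: Cr_mul => //.
  exact: ((Cr_coordP r g oU).1 cg i).
  exact: cf.
apply: (Cr_ext oU _ h) => x Ux; rewrite [RHS]diff_sum_coord.
by apply: eq_bigr => i _; rewrite deriveE //; exact: df.
Qed.

Lemma is_derive_line (V W : normedModType R) (F : V -> W) p v (s : R) :
  derivable F (p + s *: v) v ->
  is_derive s 1 (fun s => F (p + s *: v)) ('D_v F (p + s *: v)).
Proof.
have e : (fun h : R => h^-1 *: (F (p + (h *: (1 : R) + s) *: v) - F (p + s *: v)))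
       = (fun h : R => h^-1 *: (F (h *: v + (p + s *: v)) - F (p + s *: v))).
  apply/funext => h; congr (_ *: (F _ - _)).
  by rewrite scalerDl [h *: 1]mulr1 addrCA.
by move=> dF; split; rewrite /derivable /derive /= e.
Qed.

(* The mean value theorem along v, then along w.  The left side is symmetric in v
   and w, whence Schwarz. *)
Lemma second_difference m (U : set 'rV[R]_m) (f : 'rV[R]_m -> R) x v w (e : R) :
  open U -> Cr 2 U f -> U x -> 0 < e ->
  \forall h \near 0^'+,
    `|f (x + h *: v + h *: w) - f (x + h *: v) - f (x + h *: w) + f x
      - h ^+ 2 * 'D_w ('D_v f) x| <= e * h ^+ 2.
Proof.
move=> oU [df cf] Ux e0.
have dvf y : U y -> differentiable ('D_v f) y by have [+ _] := cf v; exact.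
have cwv : {for x, continuous ('D_w ('D_v f))} by have [_ /(_ w)] := cf v; exact.
have : \forall y \near x, U y /\ `|'D_w ('D_v f) x - 'D_w ('D_v f) y| < e.
  apply: filterI; first exact: open_nbhs_nbhs.
  by move/cvgrPdist_lt : cwv; exact.
move=> /nbhs_ballP[d /= d0 xd].
have xd' s t : `|s| * `|v| + `|t| * `|w| < d ->
    U (x + s *: v + t *: w) /\
    `|'D_w ('D_v f) x - 'D_w ('D_v f) (x + s *: v + t *: w)| < e.
  move=> st; apply: xd; rewrite -ball_normE /= -addrA opprD addNKr normrN.
  by apply: le_lt_trans st; rewrite (le_trans (ler_normD _ _)) // !normrZ.
near=> h.
have h0 : 0 < h by near: h; exact: nbhs_right_gt.
have hd : h * (`|v| + `|w|) < d.
  (* The summand 1 keeps the denominator positive when [v] and [w] both vanish. *)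
  have k0 : 0 < `|v| + `|w| + 1 by rewrite ltr_wpDl // addr_ge0.
  have : h < d / (`|v| + `|w| + 1).
    by near: h; apply: nbhs_right_lt; rewrite divr_gt0.
  rewrite ltr_pdivlMr // mulrDr mulr1; apply: le_lt_trans.
  by rewrite lerDl ltW.
have inU s t : 0 <= s <= h -> 0 <= t <= h ->
    U (x + s *: v + t *: w) /\
    `|'D_w ('D_v f) x - 'D_w ('D_v f) (x + s *: v + t *: w)| < e.
  move=> /andP[s0 sh] /andP[t0 th]; apply: xd'; rewrite !ger0_norm //.
  by apply: le_lt_trans hd; rewrite mulrDr lerD // ler_wpM2r.
have dline t s : 0 <= s <= h -> 0 <= t <= h ->
    is_derive s 1 (fun s => f (x + t *: w + s *: v)) ('D_v f (x + t *: w + s *: v)).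
  move=> hs ht; apply: is_derive_line; apply: diff_derivable; apply: df.
  by rewrite addrAC; have [] := inU _ _ hs ht.
have hh : 0 <= h <= h by rewrite lexx ltW.
have h00 : 0 <= (0 : R) <= h by rewrite lexx ltW.
(* The second difference is [p h - p 0]. The term [0 *: w] is kept so that both summands are
   instances of [dline]. *)
pose p s := f (x + h *: w + s *: v) - f (x + 0 *: w + s *: v).
have dp s : 0 <= s <= h -> is_derive s 1 p
    ('D_v f (x + h *: w + s *: v) - 'D_v f (x + 0 *: w + s *: v)).
  by move=> hs; exact: (@is_deriveB _ _ _ _ _ _ _ _ _ (dline _ _ hs hh) (dline _ _ hs h00)).
have itvP' (s : R) : s \in `]0, h[ -> 0 <= s <= h.
  by rewrite in_itv /= => /andP[/ltW -> /ltW ->].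
have within_cont (q q' : R -> R) : (forall s, 0 <= s <= h -> is_derive s 1 q (q' s)) ->
    {within `[0, h], continuous q}.
  move=> dq; apply: derivable_within_continuous => s; rewrite in_itv /= => hs.
  by have [] := dq s hs.
have [s1 s1h p1] := MVT h0 (fun s hs => dp s (itvP' s hs)) (within_cont _ _ dp).
pose q t := 'D_v f (x + s1 *: v + t *: w).
have dq t : 0 <= t <= h -> is_derive t 1 q ('D_w ('D_v f) (x + s1 *: v + t *: w)).
  move=> ht; apply: is_derive_line; apply: diff_derivable; apply: dvf.
  by have [] := inU _ _ (itvP' _ s1h) ht.
have [t1 t1h q1] := MVT h0 (fun s hs => dq s (itvP' s hs)) (within_cont _ _ dq).
have -> : f (x + h *: v + h *: w) - f (x + h *: v) - f (x + h *: w) + f x =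
    h ^+ 2 * 'D_w ('D_v f) (x + s1 *: v + t1 *: w).
  transitivity (p h - p 0).
    rewrite /p !scale0r !addr0 (addrAC x (h *: w)). lra.
  rewrite p1 subr0 expr2 -mulrA mulrC; congr (_ * _).
  move: q1; rewrite /q !scale0r !addr0 subr0 (addrAC x (h *: w)) => ->.
  exact: mulrC.
rewrite -mulrBr normrM ger0_norm ?sqr_ge0 // mulrC ler_wpM2r ?sqr_ge0 //.
by rewrite distrC ltW //; have [] := inU _ _ (itvP' _ s1h) (itvP' _ t1h).
Unshelve. all: by end_near. Qed.

Lemma schwarz m (U : set 'rV[R]_m) (f : 'rV[R]_m -> R) x v w :
  open U -> Cr 2 U f -> U x -> 'D_v ('D_w f) x = 'D_w ('D_v f) x.
Proof.
move=> oU cf Ux; apply/eqP; rewrite -subr_eq0 -normr_le0; apply/ler_addgt0Pr.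
move=> e e0; rewrite add0r.
have e2 : 0 < e / 2 by rewrite divr_gt0.
have A1 := second_difference v w oU cf Ux e2.
have A2 := second_difference w v oU cf Ux e2.
(* One positive [h] serving both estimates is enough: the two errors [e / 2 * h ^+ 2] add up to
   [e * h ^+ 2], and [h ^+ 2] cancels. *)
have [h [[i1 i2] h0]] := filter_ex (filterI (filterI A1 A2) (nbhs_right_gt 0)).
pose d := f (x + h *: v + h *: w) - f (x + h *: v) - f (x + h *: w) + f x.
have : `|d - h ^+ 2 * 'D_w ('D_v f) x| <= e / 2 * h ^+ 2 by exact: i1.
have : `|d - h ^+ 2 * 'D_v ('D_w f) x| <= e / 2 * h ^+ 2.
  have -> : d = f (x + h *: w + h *: v) - f (x + h *: w) - f (x + h *: v) + f x.
    by rewrite /d (addrAC x (h *: v)) (addrAC (f (x + h *: w + h *: v))).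
  exact: i2.
move=> {}i2 {}i1.
have h2 : 0 < h ^+ 2 by rewrite exprn_gt0.
rewrite -(ler_pM2l h2) -{1}(ger0_norm (ltW h2)) -normrM.
move: i1 i2; move: (d) ('D_w _ x) ('D_v _ x) => {}d a b i1 i2.
have -> : h ^+ 2 * (b - a) = d - h ^+ 2 * a - (d - h ^+ 2 * b) by ring.
rewrite (le_trans (ler_normB _ _)) // (le_trans (lerD i1 i2)) //.
by rewrite -mulrDl -splitr mulrC.
Qed.

End Smoothness.

(* Sealed, because a failing unification that unfolds ['d] practically diverges. *)
HB.lock Definition dable (R : realType) (m : nat) (V : normedModType R)
    (f : 'rV[R]_m -> V) (x : 'rV[R]_m) : Prop := differentiable f x.
HB.lock Definition dif (R : realType) (m : nat) (V : normedModType R)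
    (f : 'rV[R]_m -> V) (x v : 'rV[R]_m) : V := 'd f x v.

Section Differential.
Variable R : realType.

Lemma dableP m (V : normedModType R) (f : 'rV[R]_m -> V) x :
  dable f x <-> differentiable f x.
Proof. by rewrite dable.unlock. Qed.

Lemma Cr_dable m (V : normedModType R) r (U : set 'rV[R]_m)
  (f : 'rV[R]_m -> V) x : Cr r.+1 U f -> U x -> dable f x.
Proof. by case=> df _ Ux; apply/dableP; exact: df. Qed.

Lemma difE m (V : normedModType R) (f : 'rV[R]_m -> V) x v :
  dable f x -> dif f x v = 'D_v f x.
Proof. by move=> /dableP df; rewrite dif.unlock deriveE. Qed.

Lemma dable_near m (V : normedModType R) (f g : 'rV[R]_m -> V) x :
  (\forall y \near x, f y = g y) -> dable f x -> dable g x.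
Proof. by move=> fg /dableP df; apply/dableP; exact: differentiable_near df. Qed.

Lemma dif_near m (V : normedModType R) (f g : 'rV[R]_m -> V) x v :
  (\forall y \near x, f y = g y) -> dable f x -> dif f x v = dif g x v.
Proof. by move=> fg /dableP df; rewrite dif.unlock; exact: diff_near_app. Qed.

Lemma dif_linear m (V : normedModType R) (f : 'rV[R]_m -> V) x : linear (dif f x).
Proof. by move=> a u v; rewrite dif.unlock linearP. Qed.

Lemma difDr m (V : normedModType R) (f : 'rV[R]_m -> V) x u v :
  dif f x (u + v) = dif f x u + dif f x v.
Proof. by rewrite dif.unlock linearD. Qed.

Lemma difBr m (V : normedModType R) (f : 'rV[R]_m -> V) x u v :
  dif f x (u - v) = dif f x u - dif f x v.
Proof. by rewrite dif.unlock linearB. Qed.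

Lemma difZr m (V : normedModType R) (f : 'rV[R]_m -> V) x a v :
  dif f x (a *: v) = a *: dif f x v.
Proof. by rewrite dif.unlock linearZ. Qed.

Lemma dif0 m (V : normedModType R) (f : 'rV[R]_m -> V) x : dif f x 0 = 0.
Proof. by rewrite dif.unlock linear0. Qed.

Lemma dif_sum_coord m (V : normedModType R) (f : 'rV[R]_m -> V) x v :
  dif f x v = \sum_(i < m) v 0 i *: dif f x (delta_mx 0 i).
Proof. by rewrite dif.unlock; exact: diff_sum_coord. Qed.

Lemma dable_comp m k (V : normedModType R) (f : 'rV[R]_m -> 'rV[R]_k)
  (g : 'rV[R]_k -> V) x : dable f x -> dable g (f x) -> dable (g \o f) x.
Proof.
by move=> /dableP df /dableP dg; apply/dableP; exact: differentiable_comp.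
Qed.

Lemma dif_comp m k (V : normedModType R) (f : 'rV[R]_m -> 'rV[R]_k)
  (g : 'rV[R]_k -> V) x v : dable f x -> dable g (f x) ->
  dif (g \o f) x v = dif g (f x) (dif f x v).
Proof. by move=> /dableP df /dableP dg; rewrite dif.unlock diff_comp. Qed.

Lemma dable_coordP m k (f : 'rV[R]_m -> 'rV[R]_k) x :
  dable f x <-> forall i, dable (fun y => f y 0 i) x.
Proof.
split=> [/dableP/differentiable_coordP df i|df]; apply/dableP; first exact: df.
by apply/differentiable_coordP => i; have /dableP := df i.
Qed.

Lemma dif_coord m k (f : 'rV[R]_m -> 'rV[R]_k) x v i :
  dable f x -> dif f x v 0 i = dif (fun y => f y 0 i) x v.
Proof. by move=> /dableP df; rewrite !dif.unlock; exact: diff_coord. Qed.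

Lemma dable_cst m (V : normedModType R) (a : V) (x : 'rV[R]_m) :
  dable (fun=> a) x.
Proof. by apply/dableP; exact: differentiable_cst. Qed.

Lemma dif_cst m (V : normedModType R) (a : V) (x : 'rV[R]_m) v :
  dif (fun=> a) x v = 0.
Proof. by rewrite difE ?derive_cst //; exact: dable_cst. Qed.

Lemma dable_id m (x : 'rV[R]_m) : dable id x.
Proof. by apply/dableP; exact: ex_diff. Qed.

Lemma dif_id m (x : 'rV[R]_m) v : dif id x v = v.
Proof. by rewrite difE ?derive_id //; exact: dable_id. Qed.

Lemma dableD m (V : normedModType R) (f g : 'rV[R]_m -> V) x :
  dable f x -> dable g x -> dable (fun y => f y + g y) x.
Proof. by move=> /dableP df /dableP dg; apply/dableP; exact: differentiableD. Qed.

Lemma difD m (V : normedModType R) (f g : 'rV[R]_m -> V) x v :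
  dable f x -> dable g x ->
  dif (fun y => f y + g y) x v = dif f x v + dif g x v.
Proof.
move=> df dg; rewrite !difE //; last exact: dableD.
by move/dableP: df => df; move/dableP: dg => dg; rewrite -deriveD //;
  exact: diff_derivable.
Qed.

Lemma dableN m (V : normedModType R) (f : 'rV[R]_m -> V) x :
  dable f x -> dable (fun y => - f y) x.
Proof. by move=> /dableP df; apply/dableP; exact: differentiableN. Qed.

Lemma difN m (V : normedModType R) (f : 'rV[R]_m -> V) x v :
  dable f x -> dif (fun y => - f y) x v = - dif f x v.
Proof.
move=> df; rewrite !difE //; last exact: dableN.
by move/dableP: df => df; rewrite -deriveN //; exact: diff_derivable.
Qed.

Lemma dableM m (f g : 'rV[R]_m -> R) x :
  dable f x -> dable g x -> dable (fun y => f y * g y) x.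
Proof. by move=> /dableP df /dableP dg; apply/dableP; exact: differentiableM. Qed.

Lemma difM m (f g : 'rV[R]_m -> R) x v : dable f x -> dable g x ->
  dif (fun y => f y * g y) x v = f x * dif g x v + g x * dif f x v.
Proof.
move=> df dg; rewrite !difE //; last exact: dableM.
move/dableP: df => df; move/dableP: dg => dg.
exact: (deriveM (diff_derivable df) (diff_derivable dg)).
Qed.

Lemma dable_sum m (I : Type) (s : seq I) (V : normedModType R)
  (f : I -> 'rV[R]_m -> V) x :
  (forall i, dable (f i) x) -> dable (fun y => \sum_(i <- s) f i y) x.
Proof.
move=> df; elim: s => [|i s IH].
  apply: (dable_near _ (dable_cst 0 x)).
  by apply: filterE => y; rewrite big_nil.
apply: (dable_near _ (dableD (df i) IH)).
by apply: filterE => y; rewrite big_cons.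
Qed.

Lemma dif_sum m (I : Type) (s : seq I) (V : normedModType R)
  (f : I -> 'rV[R]_m -> V) x v : (forall i, dable (f i) x) ->
  dif (fun y => \sum_(i <- s) f i y) x v = \sum_(i <- s) dif (f i) x v.
Proof.
move=> df; elim: s => [|i s IH].
  rewrite big_nil -[RHS](dif_cst 0 x v); apply/esym.
  by apply: (dif_near _ _ (dable_cst 0 x)); apply: filterE => y; rewrite big_nil.
rewrite big_cons -IH -difD //; last exact: dable_sum.
apply/esym/dif_near; first by apply: filterE => y; rewrite big_cons.
by apply: dableD => //; exact: dable_sum.
Qed.

Lemma Cr_dif m r (U : set 'rV[R]_m) (f : 'rV[R]_m -> R)
  (g : 'rV[R]_m -> 'rV[R]_m) :
  open U -> Cr r.+1 U f -> Cr r U g -> Cr r U (fun x => dif f x (g x)).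
Proof. by move=> oU cf cg; rewrite dif.unlock; exact: Cr_diff. Qed.

Lemma Cr_dif_cst m r (U : set 'rV[R]_m) (f : 'rV[R]_m -> R) w :
  open U -> Cr r.+1 U f -> Cr r U (fun x => dif f x w).
Proof. by move=> oU cf; apply: Cr_dif => //; exact: Cr_cst. Qed.

Lemma dif_schwarz m (U : set 'rV[R]_m) (f : 'rV[R]_m -> R) x v w :
  open U -> Cr 2 U f -> U x ->
  dif (fun y => dif f y w) x v = dif (fun y => dif f y v) x w.
Proof.
move=> oU cf Ux.
have key u u' : dif (fun y => dif f y u) x u' = 'D_u' ('D_u f) x.
  have du := Cr_dable (Cr_dif_cst u oU cf) Ux.
  rewrite difE //; apply: near_eq_derive.
  apply: (@filterS _ (nbhs x) _ U); last exact: open_nbhs_nbhs.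
  by move=> y Uy; rewrite difE //; exact: Cr_dable cf Uy.
by rewrite !key; exact: (schwarz _ _ oU cf Ux).
Qed.
End Differential.

(** * Vector fields and their brackets on open subsets of R^m *)

HB.lock Definition lder (R : realType) (m : nat) (xi : 'rV[R]_m -> 'rV[R]_m)
  (a : 'rV[R]_m -> R) (y : 'rV[R]_m) : R := dif a y (xi y).
HB.lock Definition lbr (R : realType) (m : nat) (xi ze : 'rV[R]_m -> 'rV[R]_m)
  (y : 'rV[R]_m) : 'rV[R]_m := dif ze y (xi y) - dif xi y (ze y).
HB.lock Definition locfield (R : realType) (m : nat) (N : Type) (B : atlas R m N)
  (i : chart B) (X : N -> 'rV[R]_m) : 'rV[R]_m -> 'rV[R]_m :=
  localrep i (fun p => tcoord i p (X p)).

Section VectorFieldsRn.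
Variables (R : realType) (m : nat).
Implicit Types (U : set 'rV[R]_m) (a : 'rV[R]_m -> R) (xi : 'rV[R]_m -> 'rV[R]_m).

Lemma lderE xi a : lder xi a = fun y => dif a y (xi y).
Proof. by apply/funext => y; rewrite lder.unlock. Qed.

Lemma lbrE xi ze x : lbr xi ze x = dif ze x (xi x) - dif xi x (ze x).
Proof. by rewrite lbr.unlock. Qed.

(** Product rule for [da_y(ze y)]: expanding [ze] in the standard basis makes the inner directions
    constant, which separates the second derivative of [a] from the derivative of [ze]. *)
Lemma dif_lder U a ze x v : open U -> Cr 2 U a -> dable ze x -> U x ->
  dif (lder ze a) x v = dif (fun y => dif a y (ze x)) x v + dif a x (dif ze x v).
Proof.
move=> oU ca dz Ux.
have dDa w : dable (fun y => dif a y w) x.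
  exact: Cr_dable (Cr_dif_cst w oU ca) Ux.
have dzk k := (dable_coordP ze x).1 dz k.
have dprod (g : 'rV[R]_m -> 'rV[R]_m) k : dable (fun y => g y 0 k) x ->
    dable (fun y => g y 0 k * dif a y (delta_mx 0 k)) x.
  by move=> dg; exact: dableM.
have E (g : 'rV[R]_m -> 'rV[R]_m) : (fun y => dif a y (g y)) =
    fun y => \sum_(k < m) g y 0 k * dif a y (delta_mx 0 k).
  by apply/funext => y; rewrite dif_sum_coord.
rewrite lderE (E ze) (E (fun=> ze x)) !dif_sum; last 2 first.
- by move=> k; apply: (dprod (fun=> ze x)); exact: dable_cst.
- by move=> k; exact: dprod.
rewrite (dif_sum_coord a x (dif ze x v)) -big_split; apply: eq_bigr => k _ /=.
rewrite !difM ?dif_cst //; last exact: dable_cst.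
by rewrite mulr0 addr0 dif_coord // mulrC [in RHS]mulrC; congr (_ + _); exact: mulrC.
Qed.

(** Both iterated derivatives contain the second derivative of [a] in the directions [xi x] and
    [ze x]. It cancels by Schwarz, and what is left is the first derivative of [a] on the
    bracket. *)
Lemma lder_lbr U a xi ze x : open U -> Cr 2 U a -> dable xi x -> dable ze x ->
  U x -> lder xi (lder ze a) x - lder ze (lder xi a) x = lder (lbr xi ze) a x.
Proof.
move=> oU ca cx cz Ux.
rewrite (lderE xi (lder ze a)) (lderE ze (lder xi a)).
rewrite (dif_lder _ oU ca cz Ux) (dif_lder _ oU ca cx Ux).
rewrite (dif_schwarz (ze x) (xi x) oU ca Ux).
by rewrite opprD addrACA subrr add0r lderE lbrE difBr.
Qed.

Lemma Cr_lder U a xi r : open U -> Cr r.+1 U a -> Cr r U xi -> Cr r U (lder xi a).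
Proof. by rewrite lderE; exact: Cr_dif. Qed.

Lemma lbr_coord xi ze x k : dable xi x -> dable ze x ->
  lbr xi ze x 0 k =
  lder xi (fun y => ze y 0 k) x - lder ze (fun y => xi y 0 k) x.
Proof. by move=> dx dz; rewrite lbrE !lderE !mxE !dif_coord. Qed.

Lemma Cr_lbr U xi ze r : open U -> Cr r.+1 U xi -> Cr r.+1 U ze ->
  Cr r U (lbr xi ze).
Proof.
move=> oU cx cz; apply/(Cr_coordP _ _ oU) => k.
have c1 := Cr_lder oU ((Cr_coordP _ _ oU).1 cz k) (Cr_le cx).
have c2 := Cr_lder oU ((Cr_coordP _ _ oU).1 cx k) (Cr_le cz).
have cm1 : Cr r U (fun=> -1 : R) by exact: Cr_cst.
apply: (Cr_ext oU _ (Cr_add oU c1 (Cr_mul oU cm1 c2))) => x Ux.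
rewrite mulN1r lbr_coord //; first exact: Cr_dable cx Ux.
exact: Cr_dable cz Ux.
Qed.

Lemma lbr_near xi xi' ze ze' x : dable xi x -> dable ze x ->
  (\forall y \near x, xi y = xi' y) -> (\forall y \near x, ze y = ze' y) ->
  lbr xi ze x = lbr xi' ze' x.
Proof.
move=> dx dz ex ez; rewrite !lbrE (dif_near _ ex dx) (dif_near _ ez dz).
by rewrite (nbhs_singleton ex) (nbhs_singleton ez).
Qed.

(** Bracket components are commutators of derivations applied to coordinate functions. Each
    component of a double bracket thus becomes four iterated Lie derivatives, and the twelve terms
    of the cyclic sum cancel in pairs. *)
Lemma lbr_jacobi U xi ze om x : open U -> Cr 2 U xi -> Cr 2 U ze -> Cr 2 U om ->
  U x -> lbr xi (lbr ze om) x + lbr ze (lbr om xi) x + lbr om (lbr xi ze) x = 0.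
Proof.
move=> oU cx cz co Ux; apply/rowP => k.
have dU (f : 'rV[R]_m -> 'rV[R]_m) y : Cr 2 U f -> U y -> dable f y.
  by move=> cf Uy; exact: Cr_dable cf Uy.
have key al be ga : Cr 2 U al -> Cr 2 U be -> Cr 2 U ga ->
    lbr al (lbr be ga) x 0 k =
    lder al (lder be (fun y => ga y 0 k)) x
    - lder al (lder ga (fun y => be y 0 k)) x
    - (lder be (lder ga (fun y => al y 0 k)) x
    - lder ga (lder be (fun y => al y 0 k)) x).
  move=> ca cb cg; have dbg := Cr_dable (Cr_lbr oU cb cg) Ux.
  rewrite (lbr_coord _ (dU _ _ ca Ux) dbg); congr (_ - _).
    have cab := (Cr_coordP _ _ oU).1 cb k; have cag := (Cr_coordP _ _ oU).1 cg k.
    have d1 := Cr_dable (Cr_lder oU cag (Cr_le cb)) Ux.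
    have d2 := Cr_dable (Cr_lder oU cab (Cr_le cg)) Ux.
    have n : \forall y \near x, lder be (fun y => ga y 0 k) y
        + - lder ga (fun y => be y 0 k) y = lbr be ga y 0 k.
      apply: (@filterS _ (nbhs x) _ U); last exact: open_nbhs_nbhs.
      by move=> y Uy; apply/esym/lbr_coord; exact: dU.
    rewrite !(lderE al) -(dif_near _ n (dableD d1 (dableN d2))).
    by rewrite (difD _ d1 (dableN d2)) (difN _ d2).
  rewrite (lder_lbr oU _ (dU _ _ cb Ux) (dU _ _ cg Ux) Ux) //.
  exact: ((Cr_coordP _ _ oU).1 ca k).
rewrite !mxE !key //; ring.
Qed.
End VectorFieldsRn.

(* What is needed of a manifold; unlike [smooth_manifold] it makes sense for
   [slit_atlas], whose carrier has no topology. *)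
Record manifold_atlas (R : realType) (m : nat) (N : Type) (B : atlas R m N) :
    Prop := ManifoldAtlas {
  atlas_chart_at : forall p, cdom (chart_at B p) p;
  atlas_inj : forall (i : chart B) p q,
    cdom i p -> cdom i q -> cmap i p = cmap i q -> p = q;
  atlas_open : forall i j : chart B, open (cmap i @` (cdom i `&` cdom j));
  atlas_transition : forall i j : chart B,
    Cinfty (cmap i @` (cdom i `&` cdom j)) (localrep i (cmap j)) }.

(** * Change of charts, derivations and Lie brackets on a manifold *)

Section ManifoldAtlas.
Variables (R : realType) (m : nat) (N : Type) (B : atlas R m N).
Hypothesis hB : manifold_atlas B.
Implicit Types (i j k : chart B) (p q : N).

Let tau i j := localrep i (cmap j).

(** The choice hidden in [localrep] is harmless because a chart is injective on its domain. *)
Lemma localrepE (V : normedModType R) i (f : N -> V) p :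
  cdom i p -> localrep i f (cmap i p) = f p.
Proof.
move=> ip; rewrite /localrep.
case: xgetP => [y _ [q [iq qp] <-]|/(_ (f p)) []].
  by congr f; exact: (atlas_inj hB iq ip qp).
by exists p.
Qed.

Lemma nbhs_overlap i j p : cdom i p -> cdom j p ->
  \forall y \near cmap i p, exists2 q, cdom i q /\ cdom j q & y = cmap i q.
Proof.
move=> ip jp; have : nbhs (cmap i p) (cmap i @` (cdom i `&` cdom j)).
  by apply: open_nbhs_nbhs; split; [exact: atlas_open|exists p].
by apply: filterS => y [q [iq jq] <-]; exists q.
Qed.

Lemma open_cmap i : open (cmap i @` cdom i).
Proof. by rewrite -[X in cmap i @` X]setIid; exact: atlas_open. Qed.

Lemma dable_transition i j p : cdom i p -> cdom j p ->
  dable (tau i j) (cmap i p).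
Proof.
by move=> ip jp; apply: (Cr_dable (atlas_transition hB i j 1)); exists p.
Qed.

Lemma localrep_change (V : normedModType R) i j (f : N -> V) p :
  cdom i p -> cdom j p ->
  \forall y \near cmap j p, (localrep i f \o tau j i) y = localrep j f y.
Proof.
move=> ip jp; apply: filterS (nbhs_overlap jp ip) => _ [q [jq iq] ->] /=.
by rewrite /tau !localrepE.
Qed.

Lemma diff_change (V : normedModType R) i j (f : N -> V) p v :
  cdom i p -> cdom j p -> dable (localrep i f) (cmap i p) ->
  dable (localrep j f) (cmap j p) /\
  dif (localrep j f) (cmap j p) v =
  dif (localrep i f) (cmap i p) (dif (tau j i) (cmap j p) v).
Proof.
move=> ip jp df; have dt := dable_transition jp ip.
have e : tau j i (cmap j p) = cmap i p by rewrite /tau localrepE.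
have df' : dable (localrep i f) (tau j i (cmap j p)) by rewrite e.
have dc := dable_comp dt df'.
have n := localrep_change f ip jp.
split; first exact: dable_near n dc.
by rewrite -(dif_near _ n dc) (dif_comp _ dt df') /= e.
Qed.

Lemma tcoordE i p v :
  tcoord i p v = dif (tau (chart_at B p) i) (cmap (chart_at B p) p) v.
Proof. by rewrite /tcoord dif.unlock. Qed.

Lemma fderivE (V : normedModType R) X (f : N -> V) p : fderiv B X f p =
  dif (localrep (chart_at B p) f) (cmap (chart_at B p) p) (X p).
Proof. by rewrite /fderiv dif.unlock. Qed.

Lemma tcoord_id p v : tcoord (chart_at B p) p v = v.
Proof.
have kp := atlas_chart_at hB p; rewrite tcoordE.
have n : \forall y \near cmap (chart_at B p) p, id y = tau (chart_at B p) (chart_at B p) y.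
  by apply: filterS (nbhs_overlap kp kp) => _ [q [kq _] ->] /=; rewrite /tau localrepE.
by rewrite -(dif_near _ n (dable_id _)) dif_id.
Qed.

(** Cocycle rule: [tcoord j] is the differential of the transition from the preferred chart to [j],
    and the chain rule composes it with the transition from [j] to [i]. *)
Lemma tcoord_change i j p v : cdom i p -> cdom j p ->
  dif (tau j i) (cmap j p) (tcoord j p v) = tcoord i p v.
Proof.
move=> ip jp; have kp := atlas_chart_at hB p.
have [_ e] := diff_change v jp kp (dable_transition jp ip).
by rewrite !tcoordE -e.
Qed.

Lemma tcoordK i p v : cdom i p ->
  dif (tau i (chart_at B p)) (cmap i p) (tcoord i p v) = v.
Proof.
by move=> ip; rewrite tcoord_change ?tcoord_id //; exact: atlas_chart_at.
Qed.

Lemma tcoord_surj i p w : cdom i p ->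
  tcoord i p (dif (tau i (chart_at B p)) (cmap i p) w) = w.
Proof.
move=> ip; have kp := atlas_chart_at hB p.
have [_] := diff_change w kp ip (dable_transition kp ip).
have n : \forall y \near cmap i p, id y = localrep i (cmap i) y.
  by apply: filterS (nbhs_overlap ip ip) => _ [q [kq _] ->] /=; rewrite localrepE.
by rewrite -(dif_near _ n (dable_id _)) dif_id tcoordE => <-.
Qed.

Lemma tcoord_linear i p : linear (@tcoord _ _ _ B i p).
Proof. by move=> a u v; rewrite !tcoordE dif_linear. Qed.

Lemma locfieldE i X p : cdom i p -> locfield i X (cmap i p) = tcoord i p (X p).
Proof. by rewrite locfield.unlock; exact: localrepE. Qed.

Lemma Cr_locfield i X r : smooth_field B X ->
  Cr r (cmap i @` cdom i) (locfield i X).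
Proof. by rewrite locfield.unlock => /(_ i r). Qed.

Lemma smooth_dable (V : normedModType R) (f : N -> V) i p :
  smooth B f -> cdom i p -> dable (localrep i f) (cmap i p).
Proof. by move=> sf ip; apply: (Cr_dable (sf i 1)); exists p. Qed.

Lemma field_dable X i p : smooth_field B X -> cdom i p ->
  dable (locfield i X) (cmap i p).
Proof. by move=> sf ip; apply: (Cr_dable (Cr_locfield i 1 sf)); exists p. Qed.

Lemma fderiv_chart (V : normedModType R) i X (f : N -> V) p :
  cdom i p -> dable (localrep i f) (cmap i p) ->
  fderiv B X f p = dif (localrep i f) (cmap i p) (tcoord i p (X p)).
Proof.
move=> ip df; rewrite fderivE tcoordE.
by have [_ ->] := diff_change (X p) ip (atlas_chart_at hB p) df.
Qed.

Lemma localrep_fderiv i X (f : N -> R) p : smooth B f -> cdom i p ->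
  localrep i (fderiv B X f) (cmap i p) =
  lder (locfield i X) (localrep i f) (cmap i p).
Proof.
move=> sf ip; rewrite localrepE // (fderiv_chart _ ip) ?lderE ?locfieldE //.
exact: smooth_dable.
Qed.

Lemma smooth_fderiv X (f : N -> R) : smooth_field B X -> smooth B f ->
  smooth B (fderiv B X f).
Proof.
move=> sX sf i r; have oU := @open_cmap i.
apply: (Cr_ext oU _ (Cr_lder oU (sf i r.+1) (Cr_locfield i r sX))) => _ [p ip <-].
by rewrite localrep_fderiv.
Qed.

Lemma nbhs_chart i p : cdom i p ->
  \forall y \near cmap i p, exists2 q, cdom i q & y = cmap i q.
Proof.
by move=> ip; apply: filterS (nbhs_overlap ip ip) => _ [q [iq _] ->]; exists q.
Qed.

Lemma lie_at X Y p : lie B X Y p =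
  lbr (locfield (chart_at B p) X) (locfield (chart_at B p) Y)
    (cmap (chart_at B p) p).
Proof.
have kp := atlas_chart_at hB p.
by rewrite /lie !fderivE lbrE !locfieldE // !tcoord_id locfield.unlock.
Qed.

(** Chart independence of the bracket. Component [c] of the left side is the derivative of the
    component [c] of [tau k i] along the bracket, hence a commutator of derivations by [lder_lbr];
    and the derivative of that component along a field is the component [c] of the field in the
    chart [i]. *)
Lemma tcoord_lie i X Y p : smooth_field B X -> smooth_field B Y -> cdom i p ->
  tcoord i p (lie B X Y p) = lbr (locfield i X) (locfield i Y) (cmap i p).
Proof.
move=> sX sY ip; have kp := atlas_chart_at hB p; set k := chart_at B p in kp *.
apply/rowP => c; rewrite lie_at -/k tcoordE -/k.
have Up : (cmap k @` (cdom k `&` cdom i)) (cmap k p) by exists p.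
have oU : open (cmap k @` (cdom k `&` cdom i)) by exact: atlas_open.
have sU : cmap k @` (cdom k `&` cdom i) `<=` cmap k @` cdom k.
  by move=> _ [q [kq _] <-]; exists q.
have ct : Cr 2 (cmap k @` (cdom k `&` cdom i)) (tau k i).
  exact: atlas_transition.
have ctc := (Cr_coordP _ _ oU).1 ct c.
have e : tau k i (cmap k p) = cmap i p by rewrite /tau localrepE.
have dt := dable_transition kp ip.
rewrite dif_coord //.
have -> (w : 'rV[R]_m -> 'rV[R]_m) : dif (fun y => tau k i y 0 c) (cmap k p) (w (cmap k p)) =
  lder w (fun y => tau k i y 0 c) (cmap k p) by rewrite lderE.
rewrite -(lder_lbr oU ctc (field_dable sX kp) (field_dable sY kp) Up).
have dX := field_dable sX ip; have dY := field_dable sY ip.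
rewrite (lbr_coord c dX dY).
have key X' Y' : smooth_field B X' -> smooth_field B Y' ->
    lder (locfield k X') (lder (locfield k Y') (fun y => tau k i y 0 c)) (cmap k p)
    = lder (locfield i X') (fun y => locfield i Y' y 0 c) (cmap i p).
  move=> sX' sY'.
  have dY' := (dable_coordP _ _).1 (field_dable sY' ip) c.
  have dY'e : dable (fun y => locfield i Y' y 0 c) (tau k i (cmap k p)).
    by rewrite e.
  have n : \forall y \near cmap k p,
      ((fun y => locfield i Y' y 0 c) \o tau k i) y =
      lder (locfield k Y') (fun y => tau k i y 0 c) y.
    apply: filterS (nbhs_overlap kp ip) => _ [q [kq iq] ->] /=.
    have dtq := dable_transition kq iq.
    rewrite /= lderE -(dif_coord _ _ dtq) (locfieldE Y' kq) tcoord_change //.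
    by rewrite /tau localrepE // locfieldE.
  rewrite lderE -(dif_near _ n (dable_comp dt dY'e)).
  by rewrite (dif_comp _ dt dY'e) e lderE !locfieldE // tcoord_change.
by rewrite (key X Y sX sY) (key Y X sY sX).
Qed.

Lemma smooth_lie X Y : smooth_field B X -> smooth_field B Y ->
  smooth_field B (lie B X Y).
Proof.
move=> sX sY i r; have oU := @open_cmap i.
have c := Cr_lbr oU (Cr_locfield i r.+1 sX) (Cr_locfield i r.+1 sY).
apply: (Cr_ext oU _ c) => _ [p ip <-].
by rewrite localrepE // tcoord_lie.
Qed.

Lemma lieC X Y p : lie B X Y p = - lie B Y X p.
Proof. by rewrite /lie opprB. Qed.

Lemma fderiv_lie X Y (f : N -> R) p :
  smooth_field B X -> smooth_field B Y -> smooth B f ->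
  fderiv B (lie B X Y) f p =
  fderiv B X (fderiv B Y f) p - fderiv B Y (fderiv B X f) p.
Proof.
move=> sX sY sf; have kp := atlas_chart_at hB p; set k := chart_at B p in kp *.
have oU := @open_cmap k.
have Up : (cmap k @` cdom k) (cmap k p) by exists p.
have sl := smooth_lie sX sY.
rewrite -[LHS](localrepE (fderiv B (lie B X Y) f) kp).
rewrite localrep_fderiv //.
have -> : lder (locfield k (lie B X Y)) (localrep k f) (cmap k p) =
    lder (lbr (locfield k X) (locfield k Y)) (localrep k f) (cmap k p).
  by rewrite !lderE locfieldE // tcoord_lie.
rewrite -(lder_lbr oU (sf k 2) (field_dable sX kp) (field_dable sY kp) Up).
have key X' Y' : smooth_field B X' -> smooth_field B Y' ->
    fderiv B X' (fderiv B Y' f) p =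
    lder (locfield k X') (lder (locfield k Y') (localrep k f)) (cmap k p).
  move=> sX' sY'; have sYf := smooth_fderiv sY' sf.
  rewrite (fderiv_chart _ kp (smooth_dable sYf kp)) lderE locfieldE //.
  apply: dif_near; last exact: smooth_dable.
  by apply: filterS (nbhs_chart kp) => _ [q kq ->]; rewrite localrep_fderiv.
by rewrite (key X Y sX sY) (key Y X sY sX).
Qed.

Lemma lie_jacobi X Y Z p :
  smooth_field B X -> smooth_field B Y -> smooth_field B Z ->
  lie B X (lie B Y Z) p + lie B Y (lie B Z X) p + lie B Z (lie B X Y) p = 0.
Proof.
move=> sX sY sZ; have kp := atlas_chart_at hB p; set k := chart_at B p in kp *.
have Up : (cmap k @` cdom k) (cmap k p) by exists p.
rewrite -[RHS](lbr_jacobi (@open_cmap k) (Cr_locfield k 2 sX) (Cr_locfield k 2 sY)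
  (Cr_locfield k 2 sZ) Up).
have key X' Y' Z' : smooth_field B X' -> smooth_field B Y' -> smooth_field B Z' ->
    lie B X' (lie B Y' Z') p =
    lbr (locfield k X') (lbr (locfield k Y') (locfield k Z')) (cmap k p).
  move=> sX' sY' sZ'; rewrite lie_at -/k; have sl := smooth_lie sY' sZ'.
  apply: lbr_near; [exact: field_dable|exact: field_dable|exact: filterE|].
  (* At a nearby [q] the inner bracket is defined in the preferred chart of [q], not in [k];
     [tcoord_lie] is what brings it into [k]. *)
  apply: filterS (nbhs_chart kp) => _ [q kq ->].
  by rewrite locfieldE // tcoord_lie.
by rewrite (key X Y Z sX sY sZ) (key Y Z X sY sZ sX) (key Z X Y sZ sX sY).
Qed.
End ManifoldAtlas.

(** * Derivatives along lines, linear maps and block vectors *)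

Section MoreCalculus.
Variable R : realType.

Lemma near_line m (U : set 'rV[R]_m) x v : open U -> U x ->
  \forall t \near (0 : R), U (x + t *: v).
Proof.
move=> oU Ux; have c : (fun t : R => x + t *: v) @ (0 : R) --> x.
  rewrite -[X in _ --> X]addr0 -[X in _ + X](scale0r v).
  by apply: cvgD; [exact: cvg_cst|apply: cvgZr_tmp; exact: cvg_id].
by apply: c; exact: open_nbhs_nbhs.
Qed.

(** For functions that are exactly affine on a short segment: linear maps, transitions along the
    fibres, and the fibre differential of the energy along a ray. *)
Lemma derive_affine m (V : normedModType R) (f : 'rV[R]_m -> V) x v a :
  (\forall h \near (0 : R), f (x + h *: v) = f x + h *: a) -> 'D_v f x = a.
Proof.
move=> fa; rewrite /derive; apply: cvg_lim => //.
have ca : (fun=> a) @ (0 : R)^' --> a by exact: cvg_cst.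
apply: cvg_trans ca; apply: near_eq_cvg.
have fa' : \forall h \near (0 : R)^', f (x + h *: v) = f x + h *: a.
  exact: cvg_within fa.
have n0 : \forall h \near (0 : R)^', h != 0 by exact: nbhs_dnbhs_neq.
apply: filterS2 fa' n0 => h fh h0.
by rewrite /= [h *: v + x]addrC fh addrAC subrr add0r scalerA mulVf // scale1r.
Qed.

(** Agreement near [0] is all that fibres can provide: a line in a fibre may run into the zero
    vector, which is not in the slit bundle. *)
Lemma derive1_line m (V : normedModType R) (phi : R -> V) (F : 'rV[R]_m -> V) x v :
  (\forall t \near (0 : R), phi t = F (x + t *: v)) -> dable F x ->
  derive1 phi 0 = dif F x v.
Proof.
move=> pF dF; have dF' := dF; move/dableP: dF' => dF'.
have e : F x = F (x + 0 *: v) by rewrite scale0r addr0.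
have d0 : derivable F (x + 0 *: v) v by rewrite scale0r addr0; exact: diff_derivable.
have [_ d1] := is_derive_line d0.
by rewrite derive1E (near_eq_derive _ pF) d1 scale0r addr0 difE.
Qed.

Lemma Cr_scale m k r (U : set 'rV[R]_m) (f : 'rV[R]_m -> R)
  (g : 'rV[R]_m -> 'rV[R]_k) :
  open U -> Cr r U f -> Cr r U g -> Cr r U (fun x => f x *: g x).
Proof.
move=> oU cf cg; apply/(Cr_coordP _ _ oU) => i.
apply: (Cr_ext oU _ (Cr_mul oU cf ((Cr_coordP _ _ oU).1 cg i))) => x _.
by rewrite mxE.
Qed.

Lemma Cr_linfun m k r (U : set 'rV[R]_m) (f : 'rV[R]_m -> 'rV[R]_k) :
  linear f -> Cr r setT f.
Proof.
move=> lf; pose fL : {linear 'rV[R]_m -> 'rV[R]_k} :=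
  HB.pack f (GRing.isLinear.Build _ _ _ _ _ lf).
have h : Cr r setT (fun x => \sum_(i < m) x 0 i *: f (delta_mx 0 i)).
  apply: Cr_sum => [|i]; first exact: openT.
  by apply: Cr_scale; [exact: openT|exact: Cr_coord|exact: Cr_cst].
apply: (Cr_ext openT _ h) => x _.
rewrite [in RHS](row_sum_delta x) -[f]/(fL : _ -> _) linear_sum.
by apply: eq_bigr => i _; rewrite linearZ.
Qed.

Lemma dable_linfun m k (f : 'rV[R]_m -> 'rV[R]_k) x : linear f -> dable f x.
Proof. by move=> lf; exact: (Cr_dable (Cr_linfun 1 setT lf)). Qed.

Lemma dif_linfun m k (f : 'rV[R]_m -> 'rV[R]_k) x v : linear f -> dif f x v = f v.
Proof.
move=> lf; rewrite difE; last exact: dable_linfun.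
by apply: derive_affine; apply: filterE => h; rewrite addrC lf addrC.
Qed.

Lemma dif_linfun_comp m k l (f : 'rV[R]_k -> 'rV[R]_l) (g : 'rV[R]_m -> 'rV[R]_k) x v :
  linear f -> dable g x -> dif (fun y => f (g y)) x v = f (dif g x v).
Proof.
move=> lf dg; have df := dable_linfun (g x) lf.
by rewrite (dif_comp v dg df) dif_linfun.
Qed.

Lemma lsubmx_linear k l : linear (@lsubmx R 1 k l).
Proof. by move=> a u v; rewrite linearP. Qed.
Lemma rsubmx_linear k l : linear (@rsubmx R 1 k l).
Proof. by move=> a u v; rewrite linearP. Qed.

Lemma Cr_lsubmx k l r U : Cr r U (@lsubmx R 1 k l).
Proof. by apply: Cr_sub (Cr_linfun r setT (@lsubmx_linear k l)). Qed.
Lemma Cr_rsubmx k l r U : Cr r U (@rsubmx R 1 k l).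
Proof. by apply: Cr_sub (Cr_linfun r setT (@rsubmx_linear k l)). Qed.

Lemma Cr_row_mx m k l r (U : set 'rV[R]_m) (f : 'rV[R]_m -> 'rV[R]_k)
  (g : 'rV[R]_m -> 'rV[R]_l) :
  open U -> Cr r U f -> Cr r U g -> Cr r U (fun x => row_mx (f x) (g x)).
Proof.
move=> oU cf cg; apply/(Cr_coordP _ _ oU) => i.
case: (split_ordP i) => j ->.
- apply: (Cr_ext oU _ ((Cr_coordP _ _ oU).1 cf j)) => x _.
  by rewrite row_mxEl.
- apply: (Cr_ext oU _ ((Cr_coordP _ _ oU).1 cg j)) => x _.
  by rewrite row_mxEr.
Qed.

Lemma Cr_dif_comp m k r (U : set 'rV[R]_m) (U' : set 'rV[R]_k)
  (f : 'rV[R]_k -> R) (g h : 'rV[R]_m -> 'rV[R]_k) :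
  open U -> open U' -> (forall x, U x -> U' (g x)) ->
  Cr r.+1 U' f -> Cr r U g -> Cr r U h ->
  Cr r U (fun x => dif f (g x) (h x)).
Proof.
move=> oU oU' gU cf cg ch.
have c : Cr r U (fun x => \sum_(i < k) h x 0 i * dif f (g x) (delta_mx 0 i)).
  apply: Cr_sum => // i; apply: Cr_mul => //.
    exact: ((Cr_coordP r h oU).1 ch i).
  exact: (Cr_comp oU gU (Cr_dif_cst (delta_mx 0 i) oU' cf) cg).
by apply: (Cr_ext oU _ c) => x _; rewrite [RHS]dif_sum_coord.
Qed.

Lemma Cr_dif_comp_row m k l r (U : set 'rV[R]_m) (U' : set 'rV[R]_k)
  (f : 'rV[R]_k -> 'rV[R]_l) (g h : 'rV[R]_m -> 'rV[R]_k) :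
  open U -> open U' -> (forall x, U x -> U' (g x)) ->
  Cr r.+1 U' f -> Cr r U g -> Cr r U h ->
  Cr r U (fun x => dif f (g x) (h x)).
Proof.
move=> oU oU' gU cf cg ch; apply/(Cr_coordP _ _ oU) => i.
have c := Cr_dif_comp oU oU' gU ((Cr_coordP _ _ oU').1 cf i) cg ch.
apply: (Cr_ext oU _ c) => x Ux; rewrite dif_coord //.
exact: Cr_dable cf (gU _ Ux).
Qed.
End MoreCalculus.

(** * Smooth functions and sections as modules *)

Section SmoothSections.
Variables (R : realType) (m : nat) (N : Type) (B : atlas R m N).
Hypothesis hB : manifold_atlas B.

Lemma smooth_ext (f g : N -> R) : (forall p, f p = g p) -> smooth B f -> smooth B g.
Proof. by move=> /funext ->. Qed.

Lemma smooth_cst (a : R) : smooth B (fun=> a).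
Proof.
move=> i r; have oU := open_cmap hB (i := i).
have ca : Cr r (cmap i @` cdom i) (fun=> a) by exact: Cr_cst.
by apply: (Cr_ext oU _ ca) => _ [p ip <-]; rewrite localrepE.
Qed.

Lemma smoothD (f g : N -> R) : smooth B f -> smooth B g ->
  smooth B (fun p => f p + g p).
Proof.
move=> sf sg i r; have oU := open_cmap hB (i := i).
by apply: (Cr_ext oU _ (Cr_add oU (sf i r) (sg i r))) => _ [p ip <-];
  rewrite !localrepE.
Qed.

Lemma smoothM (f g : N -> R) : smooth B f -> smooth B g ->
  smooth B (fun p => f p * g p).
Proof.
move=> sf sg i r; have oU := open_cmap hB (i := i).
by apply: (Cr_ext oU _ (Cr_mul oU (sf i r) (sg i r))) => _ [p ip <-];
  rewrite !localrepE.
Qed.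

Lemma smooth_sum (I : Type) (s : seq I) (f : I -> N -> R) :
  (forall i, smooth B (f i)) -> smooth B (fun p => \sum_(i <- s) f i p).
Proof.
move=> sf; elim: s => [|i s IH].
  by apply: smooth_ext (smooth_cst 0) => p; rewrite big_nil.
by apply: smooth_ext (smoothD (sf i) IH) => p; rewrite big_cons.
Qed.

Lemma smooth_prod (I : Type) (s : seq I) (f : I -> N -> R) :
  (forall i, smooth B (f i)) -> smooth B (fun p => \prod_(i <- s) f i p).
Proof.
move=> sf; elim: s => [|i s IH].
  by apply: smooth_ext (smooth_cst 1) => p; rewrite big_nil.
by apply: smooth_ext (smoothM (sf i) IH) => p; rewrite big_cons.
Qed.

Lemma smooth_det k (G : N -> 'M[R]_k) :
  (forall i j, smooth B (fun p => G p i j)) -> smooth B (fun p => \det (G p)).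
Proof.
move=> sG; rewrite /determinant; apply: smooth_sum => s.
by apply: smoothM; [exact: smooth_cst|apply: smooth_prod => i; exact: sG].
Qed.

Lemma smooth_adj k (G : N -> 'M[R]_k) i j :
  (forall i j, smooth B (fun p => G p i j)) -> smooth B (fun p => (\adj (G p)) i j).
Proof.
move=> sG; apply: smooth_ext (_ : smooth B (fun p => cofactor (G p) j i)).
  by move=> p; rewrite mxE.
rewrite /cofactor; apply: smoothM; first exact: smooth_cst.
apply: smooth_det => a b; apply: smooth_ext (sG (lift j a) (lift i b)) => p.
by rewrite !mxE.
Qed.

(* Tangent vector fields and pi-vector fields are treated alike: c i p maps a
   vector at p to its components in the chart i. *)
Variables (k : nat) (c : chart B -> N -> 'rV[R]_k -> 'rV[R]_k).
Hypothesis lc : forall i p, linear (c i p).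

Definition smooth_section (X : N -> 'rV[R]_k) : Prop :=
  forall i, Cinfty (cmap i @` cdom i) (localrep i (fun p => c i p (X p))).

Lemma smooth_section0 : smooth_section (fun=> 0).
Proof.
move=> i r; have oU := open_cmap hB (i := i).
have c0 : Cr r (cmap i @` cdom i) (fun=> 0 : 'rV[R]_k) by exact: Cr_cst.
apply: (Cr_ext oU _ c0) => _ [p ip <-]; rewrite localrepE //; have := lc i p (-1) 0 0.
by rewrite scaler0 addr0 scaleN1r addNr.
Qed.

Lemma smooth_sectionD X Y : smooth_section X -> smooth_section Y ->
  smooth_section (X \+ Y).
Proof.
move=> sX sY i r; have oU := open_cmap hB (i := i).
apply: (Cr_ext oU _ (Cr_add oU (sX i r) (sY i r))) => _ [p ip <-].
by have := lc i p 1 (X p) (Y p); rewrite !localrepE // !scale1r => ->.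
Qed.

Lemma smooth_sectionZ (f : N -> R) X : smooth B f -> smooth_section X ->
  smooth_section (fun p => f p *: X p).
Proof.
move=> sf sX i r; have oU := open_cmap hB (i := i).
apply: (Cr_ext oU _ (Cr_scale oU (sf i r) (sX i r))) => _ [p ip <-].
rewrite !localrepE //=.
have c0 : c i p 0 = 0.
  by have := lc i p (-1) 0 0; rewrite scaler0 addr0 scaleN1r addNr.
by have := lc i p (f p) (X p) 0; rewrite c0 !addr0.
Qed.

Lemma smooth_section_sum (I : Type) (s : seq I) (X : I -> N -> 'rV[R]_k) :
  (forall i, smooth_section (X i)) ->
  smooth_section (fun p => \sum_(i <- s) X i p).
Proof.
move=> sX; elim: s => [|i s IH].
  have -> : (fun p => \sum_(i <- [::]) X i p) = fun=> 0.
    by apply/funext => p; rewrite big_nil.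
  exact: smooth_section0.
have -> : (fun p => \sum_(j <- i :: s) X j p) = X i \+ (fun p => \sum_(j <- s) X j p).
  by apply/funext => p; rewrite big_cons.
exact: smooth_sectionD.
Qed.

(** Near [p] the factor [h] does not vanish and can be divided out. Cramer's rule produces fields
    only up to such a factor, and [smooth_beta] recovers the field itself in this way. *)
Lemma smooth_section_local X :
  (forall p, exists2 h : N -> R, smooth B h /\ h p != 0 &
     smooth_section (fun q => h q *: X q)) -> smooth_section X.
Proof.
move=> loc i r; apply: Cr_local => _ [p ip <-].
have [h [sh hp] shX] := loc p; have oU := open_cmap hB (i := i).
pose U := [set x | (cmap i @` cdom i) x /\ localrep i h x != 0].
have oU' : open U.
  rewrite openE => x [Ux hx]; have /dableP dh := Cr_dable (sh i 1) Ux.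
  have ch : {for x, continuous (localrep i h)} := differentiable_continuous dh.
  rewrite /interior /=; apply: filterI; first exact: open_nbhs_nbhs.
  by apply: (ch [set y | y != 0]); apply: open_nbhs_nbhs; split; [exact: open_neq|].
have sU : U `<=` cmap i @` cdom i by move=> x [].
exists U; first by split; [exists p|rewrite localrepE].
have c1 := Cr_inv oU' (fun x Ux => Ux.2) (Cr_sub sU (sh i r)).
apply: (Cr_ext oU' _ (Cr_scale oU' c1 (Cr_sub sU (shX i r)))) => x [[q iq <-]].
rewrite !localrepE // => hq.
have c0 : c i q 0 = 0.
  by have := lc i q (-1) 0 0; rewrite scaler0 addr0 scaleN1r addNr.
have := lc i q (h q) (X q) 0; rewrite c0 !addr0 => ->.
by rewrite scalerA mulVf // scale1r.
Qed.
End SmoothSections.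

Lemma smooth_manifold_atlas (R : realType) (m : nat) (M : topologicalType)
  (A : atlas R m M) : smooth_manifold A -> manifold_atlas A.
Proof.
move=> hM; split.
- exact: manifold_chart_at.
- exact: manifold_inj.
- move=> i j; apply: (manifold_open_map hM).
    by move=> p [].
  by apply: openI; exact: manifold_open_dom.
- exact: manifold_transition.
Qed.

(** * The slit tangent bundle as a manifold; [rho] and [gamma] in coordinates *)

Section Slit.
Variables (R : realType) (n : nat) (M : Type) (A : atlas R n M).
Hypothesis hA : manifold_atlas A.
Notation slit := (slit R n M).
Notation SA := (slit_atlas A).
Implicit Types (i j k : chart A) (u : slit).

Lemma slit_cmapE i u : @cmap _ _ _ SA i u =
  row_mx (cmap i (foot u)) (tcoord i (foot u) (eta u)).
Proof. by []. Qed.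

Lemma tcoord0 i p : tcoord i p (0 : 'rV[R]_n) = 0.
Proof.
have := tcoord_linear i p (-1) 0 0.
by rewrite scaler0 addr0 scaleN1r addNr.
Qed.

Lemma tcoord_eq0 i p (v : 'rV[R]_n) : cdom i p -> tcoord i p v = 0 -> v = 0.
Proof.
move=> ip e; rewrite -(tcoordK hA v ip) e.
exact: dif0.
Qed.

(** A vector is nonzero exactly when its components in a chart are, so an overlap in the slit bundle
    is an open overlap in the base times the nonzero vectors. Openness is read off from this
    product. *)
Lemma slit_image i j :
  (@cmap _ _ _ SA i) @` (@cdom _ _ _ SA i `&` @cdom _ _ _ SA j) =
  [set w | (cmap i @` (cdom i `&` cdom j)) (lsubmx w) /\ rsubmx w != 0].
Proof.
apply/seteqP; split=> [_ [u [iu ju] <-]|w [[p [ip jp] pw] w0]].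
  split; rewrite slit_cmapE ?row_mxKl ?row_mxKr; first by exists (foot u).
  by apply: contra_neq (svalP u); exact: tcoord_eq0.
pose v := dif (localrep i (cmap (chart_at A p))) (cmap i p) (rsubmx w).
have tv : tcoord i p v = rsubmx w by exact: tcoord_surj.
have v0 : (p, v).2 != 0.
  by apply: contra_neq w0 => /= v0; rewrite -tv v0 tcoord0.
exists (exist (fun u : M * 'rV[R]_n => u.2 != 0) (p, v) v0) => //.
by rewrite slit_cmapE /foot /eta /= tv pw hsubmxK.
Qed.

Lemma open_slit_image i j : open
  ((@cmap _ _ _ SA i) @` (@cdom _ _ _ SA i `&` @cdom _ _ _ SA j)).
Proof.
rewrite slit_image; apply: openI.
  by apply: open_comp; [move=> w _; exact: continuous_lsubmx|exact: atlas_open].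
have o0 : open [set y : 'rV[R]_n | y != 0].
  have -> : [set y : 'rV[R]_n | y != 0] = ~` [set 0].
    by apply/seteqP; split=> y /eqP.
  rewrite openC; apply: accessible_closed_set1.
  exact: (hausdorff_accessible (@norm_hausdorff _ _)).
apply: (@open_comp _ _ (@rsubmx R 1 n n) _ _ o0).
by move=> w _; exact: continuous_rsubmx.
Qed.

Lemma slit_inj i u u' : cdom i (foot u) -> cdom i (foot u') ->
  @cmap _ _ _ SA i u = @cmap _ _ _ SA i u' -> u = u'.
Proof.
move=> iu iu'; rewrite !slit_cmapE => /eq_row_mx[e1 e2].
have e := atlas_inj hA iu iu' e1; apply: val_inj.
case: u u' iu iu' {e1} e2 e => [[p v] pv] [[q w] qw]; rewrite /foot /eta /=.
move=> ip _ e2 e; rewrite -e in e2 *; congr (_, _).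
by rewrite -(tcoordK hA v ip) e2 tcoordK.
Qed.

Lemma localrep_slit (V : normedModType R) i (f : slit -> V) u :
  cdom i (foot u) -> localrep (A := SA) i f (@cmap _ _ _ SA i u) = f u.
Proof.
move=> ip; rewrite /localrep.
case: xgetP => [y _ [q [iq qp] <-]|/(_ (f u)) []].
  by congr f; exact: slit_inj qp.
by exists u.
Qed.

Lemma slit_transition i j u : cdom i (foot u) -> cdom j (foot u) ->
  localrep (A := SA) i (@cmap _ _ _ SA j) (@cmap _ _ _ SA i u) =
  row_mx (localrep i (cmap j) (lsubmx (@cmap _ _ _ SA i u)))
    (dif (localrep i (cmap j)) (lsubmx (@cmap _ _ _ SA i u))
      (rsubmx (@cmap _ _ _ SA i u))).
Proof.
move=> iu ju; rewrite localrep_slit // !slit_cmapE row_mxKl row_mxKr.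
by rewrite localrepE // tcoord_change.
Qed.

Lemma slit_transition_smooth i j :
  Cinfty ((@cmap _ _ _ SA i) @` (@cdom _ _ _ SA i `&` @cdom _ _ _ SA j))
    (localrep (A := SA) i (@cmap _ _ _ SA j)).
Proof.
move=> r; have oU := @open_slit_image i j; set W := _ @` _ in oU *.
have oV := @atlas_open _ _ _ _ hA i j.
have lW w : W w -> (cmap i @` (cdom i `&` cdom j)) (lsubmx w).
  by rewrite /W slit_image => -[].
have ct s : Cr s (cmap i @` (cdom i `&` cdom j)) (localrep i (cmap j)).
  exact: atlas_transition.
have c1 := Cr_comp_row oU oV lW (ct r) (@Cr_lsubmx _ n n r W).
have c2 := Cr_dif_comp_row oU oV lW (ct r.+1) (@Cr_lsubmx _ n n r W)
  (@Cr_rsubmx _ n n r W).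
apply: (Cr_ext oU _ (Cr_row_mx oU c1 c2)) => _ [u [iu ju] <-].
by rewrite slit_transition.
Qed.

Lemma slit_manifold_atlas : manifold_atlas SA.
Proof.
split.
- by move=> u; exact: (atlas_chart_at hA (foot u)).
- exact: slit_inj.
- exact: open_slit_image.
- exact: slit_transition_smooth.
Qed.
Let hS := slit_manifold_atlas.

Let nbhs_slit i j u := nbhs_overlap hS (i := i) (j := j) (p := u).

Lemma lsubmx_tcoord i u (w : 'rV[R]_(n + n)) : cdom i (foot u) ->
  lsubmx (tcoord (A := SA) i u w) = tcoord i (foot u) (lsubmx w).
Proof.
move=> iu; have ku := atlas_chart_at hA (foot u).
set k := chart_at A (foot u) in ku *.
have dt := dable_transition hS (i := k) (j := i) (p := u) ku iu.
have dA := dable_transition hA ku iu.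
rewrite !tcoordE -/k -(dif_linfun_comp w (@lsubmx_linear R n n) dt).
have el : lsubmx (@cmap _ _ _ SA k u) = cmap k (foot u).
  by rewrite slit_cmapE row_mxKl.
have dl := dable_linfun (@cmap _ _ _ SA k u) (@lsubmx_linear R n n).
have dA' : dable (localrep k (cmap i)) (lsubmx (@cmap _ _ _ SA k u)) by rewrite el.
have nl : \forall y \near @cmap _ _ _ SA k u,
    (localrep k (cmap i) \o lsubmx) y = lsubmx (localrep (A := SA) k (@cmap _ _ _ SA i) y).
  apply: filterS (nbhs_slit ku iu) => _ [q [kq iq] ->]; by rewrite slit_transition // row_mxKl.
rewrite -(dif_near w nl (dable_comp dl dA')) (dif_comp w dl dA') el.
by rewrite (dif_linfun _ _ (@lsubmx_linear R n n)).
Qed.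

(** Transitions of the tangent bundle are linear on fibres, hence exactly affine along a vertical
    line. *)
Lemma tcoord_vertical i u (b : 'rV[R]_n) : cdom i (foot u) ->
  tcoord (A := SA) i u (row_mx 0 b) = row_mx 0 (tcoord i (foot u) b).
Proof.
move=> iu; have ku := atlas_chart_at hA (foot u).
set k := chart_at A (foot u) in ku *.
have dt := dable_transition hS (i := k) (j := i) (p := u) ku iu.
rewrite !tcoordE -/k difE //; apply: derive_affine.
have ou := @open_slit_image k i.
have Wu : ((@cmap _ _ _ SA k) @` (@cdom _ _ _ SA k `&` @cdom _ _ _ SA i)) (@cmap _ _ _ SA k u).
  by exists u.
apply: filterS (near_line (row_mx 0 b) ou Wu) => h [q [kq iq] e].
rewrite -e !slit_transition // e scale_row_mx scaler0 slit_cmapE add_row_mx addr0.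
rewrite !row_mxKl !row_mxKr scale_row_mx scaler0 add_row_mx addr0.
by rewrite difDr difZr.
Qed.

(** The preferred chart at [u] is induced by the one at [foot u], so in these two charts the
    projection is literally the first block. *)
Lemma dpiE u w : dpi A u w = lsubmx w.
Proof.
have ku := atlas_chart_at hA (foot u).
rewrite /dpi /mdiff; set k := chart_at A (foot u) in ku *.
have -> : @chart_at _ _ _ SA u = k by [].
have dl := dable_linfun (@cmap _ _ _ SA k u) (@lsubmx_linear R n n).
have nl : \forall y \near @cmap _ _ _ SA k u,
    lsubmx y = localrep (A := SA) k (fun q => cmap k (foot q)) y.
  apply: filterS (nbhs_slit ku ku) => _ [q [kq _] ->].
  by rewrite localrep_slit // slit_cmapE row_mxKl.
have := dif_near w nl dl; rewrite (dif_linfun _ _ (@lsubmx_linear R n n)) => ->.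
by rewrite dif.unlock.
Qed.

Lemma rhoE X u : rho A X u = lsubmx (X u).
Proof. exact: dpiE. Qed.

Lemma gammaE X u : gamma A X u = row_mx 0 (X u).
Proof.
rewrite /gamma /=; set k := chart_at A (foot u).
have dI := dable_id (row_mx (cmap k (foot u)) (eta u)).
rewrite -[RHS](dif_id (row_mx (cmap k (foot u)) (eta u))).
apply: derive1_line dI; apply: filterE => t.
by rewrite /k tcoord_id // scale_row_mx scaler0 add_row_mx addr0.
Qed.
End Slit.

(** * Smooth fields on the slit bundle and brackets with vertical fields *)

HB.lock Definition locpi (R : realType) (n : nat) (M : Type) (A : atlas R n M)
  (i : chart A) (X : pifield R n M) : 'rV[R]_(n + n) -> 'rV[R]_n :=
  localrep (A := slit_atlas A) i (fun u => tcoord i (foot u) (X u)).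

Section SlitFields.
Variables (R : realType) (n : nat) (M : Type) (A : atlas R n M).
Hypothesis hA : manifold_atlas A.
Notation slit := (slit R n M).
Notation SA := (slit_atlas A).
Notation scmap i := (@cmap _ _ _ SA i).
Implicit Types (i j k : chart A) (u : slit) (X Y : vfield R n M) (U V Z : pifield R n M).
Let hS := slit_manifold_atlas hA.
Let O i := @cmap _ _ _ SA i @` @cdom _ _ _ SA i.

Lemma locpiE i Z u : cdom i (foot u) -> locpi i Z (scmap i u) = tcoord i (foot u) (Z u).
Proof. by move=> iu; rewrite locpi.unlock localrep_slit. Qed.

Lemma Cr_locpi i Z r : smooth_pifield A Z -> Cr r (O i) (locpi i Z).
Proof. by rewrite locpi.unlock => /(_ i r). Qed.

Lemma open_O i : open (O i).
Proof. exact: (open_cmap hS). Qed.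

Lemma nbhs_O i u : cdom i (foot u) ->
  \forall y \near scmap i u, exists2 q, cdom i (foot q) & y = scmap i q.
Proof. exact: (nbhs_chart hS (i := i) (p := u)). Qed.

Lemma pifield_dable i Z u : smooth_pifield A Z -> cdom i (foot u) ->
  dable (locpi i Z) (scmap i u).
Proof. by move=> sZ iu; apply: (Cr_dable (Cr_locpi i 1 sZ)); exists u. Qed.

Lemma smooth_pifield_ext i Z (f : 'rV[R]_(n + n) -> 'rV[R]_n) r :
  Cr r (O i) f ->
  (forall u, cdom i (foot u) -> f (scmap i u) = tcoord i (foot u) (Z u)) ->
  Cr r (O i) (localrep (A := SA) i (fun u => tcoord i (foot u) (Z u))).
Proof.
move=> cf fE; apply: (Cr_ext (@open_O i) _ cf) => _ [u iu <-].
by rewrite localrep_slit // fE.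
Qed.

Lemma smooth_eta : smooth_pifield A (@eta R n M).
Proof.
move=> i r; apply: (smooth_pifield_ext (f := rsubmx)); first exact: Cr_rsubmx.
by move=> u iu; rewrite slit_cmapE row_mxKr.
Qed.

Lemma smooth_rho X : smooth_field SA X -> smooth_pifield A (rho A X).
Proof.
move=> sX i r.
have c := Cr_comp_row (@open_O i) (@openT _) (fun _ _ => I)
  (Cr_linfun r setT (@lsubmx_linear R n n)) (Cr_locfield i r sX).
apply: (smooth_pifield_ext c) => u iu.
by rewrite (locfieldE hS X (p := u)) // lsubmx_tcoord // rhoE.
Qed.

Lemma smooth_gamma Z : smooth_pifield A Z -> smooth_field SA (gamma A Z).
Proof.
move=> sZ i r.
have c0 : Cr r (O i) (fun=> 0 : 'rV[R]_n) by exact: Cr_cst.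
apply: (Cr_ext (@open_O i) _ (Cr_row_mx (@open_O i) c0 (Cr_locpi i r sZ))).
by move=> _ [u iu <-]; rewrite localrep_slit // gammaE // tcoord_vertical // locpiE.
Qed.

Lemma locfield_gamma i Z u : cdom i (foot u) ->
  locfield (B := SA) i (gamma A Z) (scmap i u) = row_mx 0 (locpi i Z (scmap i u)).
Proof.
by move=> iu; rewrite (locfieldE hS _ (p := u)) // gammaE // tcoord_vertical // locpiE.
Qed.

Lemma vertical_field X : smooth_field SA X -> (forall u, rho A X u = 0) ->
  exists2 V, smooth_pifield A V & X = gamma A V.
Proof.
move=> sX X0; exists (fun u => rsubmx (X u)); last first.
  apply/funext => u; rewrite gammaE // -[LHS]hsubmxK; congr row_mx.
  by rewrite -[RHS](X0 u) rhoE.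
move=> i r.
have c := Cr_comp_row (@open_O i) (@openT _) (fun _ _ => I)
  (Cr_linfun r setT (@rsubmx_linear R n n)) (Cr_locfield i r sX).
apply: (smooth_pifield_ext c) => u iu.
have eX : X u = row_mx 0 (rsubmx (X u)).
  by rewrite -[LHS]hsubmxK -[lsubmx _](rhoE hA) X0.
by rewrite (locfieldE hS X (p := u)) // eX tcoord_vertical // !row_mxKr.
Qed.

(** The base components of [gamma U] vanish throughout the chart, so only one term of the bracket
    survives the projection: the derivative of the base components of [X] in the vertical direction
    [U]. *)
Lemma rho_lie_gamma U X u : smooth_pifield A U -> smooth_field SA X ->
  rho A (lie SA (gamma A U) X) u =
  dif (locpi (chart_at A (foot u)) (rho A X)) (scmap (chart_at A (foot u)) u)
    (row_mx 0 (U u)).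
Proof.
move=> sU sX; have ku := atlas_chart_at hA (foot u).
have sgU := smooth_gamma sU.
rewrite rhoE // (lie_at hS) lbrE.
have -> : @chart_at _ _ _ SA u = chart_at A (foot u) by [].
set k := chart_at A (foot u) in ku *.
have dX : dable (locfield (B := SA) k X) (scmap k u).
  exact: (@field_dable _ _ _ SA X k u sX ku).
have dU : dable (locfield (B := SA) k (gamma A U)) (scmap k u).
  exact: (@field_dable _ _ _ SA _ k u sgU ku).
rewrite linearB /= -!(dif_linfun_comp _ (@lsubmx_linear R n n)) //.
have -> : locfield (B := SA) k (gamma A U) (scmap k u) = row_mx 0 (U u).
  by rewrite locfield_gamma // locpiE // tcoord_id.
have dz : dable (fun=> 0 : 'rV[R]_n) (scmap k u) by exact: dable_cst.
have nz : \forall y \near scmap k u, 0 = lsubmx (locfield (B := SA) k (gamma A U) y).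
  apply: filterS (nbhs_O ku) => _ [q kq ->].
  by rewrite locfield_gamma // row_mxKl.
rewrite -(dif_near _ nz dz) dif_cst subr0.
have dr := pifield_dable (smooth_rho sX) ku.
apply/esym/dif_near => //.
apply: filterS (nbhs_O ku) => _ [q kq ->].
by rewrite locpiE // rhoE // (locfieldE hS X (p := q)) // lsubmx_tcoord.
Qed.

Lemma rho_lie_gamma_gamma U V u : smooth_pifield A U -> smooth_pifield A V ->
  rho A (lie SA (gamma A U) (gamma A V)) u = 0.
Proof.
move=> sU sV; rewrite rho_lie_gamma //; last exact: smooth_gamma.
have ku := atlas_chart_at hA (foot u); set k := chart_at A (foot u) in ku *.
have dz : dable (fun=> 0 : 'rV[R]_n) (scmap k u) by exact: dable_cst.
rewrite -(dif_near (f := fun=> 0) _ _ dz) ?dif_cst //.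
apply: filterS (nbhs_O ku) => _ [q kq ->].
by rewrite locpiE // rhoE // gammaE // row_mxKl tcoord0.
Qed.

(** In a chart the components of [eta] are the fibre coordinates themselves, and their derivative in
    the vertical direction [U] is [U]. *)
Lemma rho_lie_gamma_eta U X u : smooth_pifield A U -> smooth_field SA X ->
  rho A X = @eta R n M -> rho A (lie SA (gamma A U) X) u = U u.
Proof.
move=> sU sX Xe; rewrite rho_lie_gamma // Xe.
have ku := atlas_chart_at hA (foot u); set k := chart_at A (foot u) in ku *.
have dz := dable_linfun (scmap k u) (@rsubmx_linear R n n).
rewrite -(dif_near (f := rsubmx) _ _ dz).
  by rewrite (dif_linfun _ _ (@rsubmx_linear R n n)) row_mxKr.
apply: filterS (nbhs_O ku) => _ [q kq ->].
by rewrite locpiE // slit_cmapE row_mxKr.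
Qed.

(** Since the chart image is open, a short vertical coordinate segment consists of images of genuine
    points, and injectivity of the base chart keeps their foot fixed. Derivatives along a fibre
    thereby become differentials in the chart. *)
Lemma fibre_line i u (v : 'rV[R]_n) : cdom i (foot u) ->
  \forall t \near (0 : R), exists u', [/\ foot u' = foot u,
    eta u' = eta u + t *: v &
    scmap i u' = scmap i u + t *: row_mx 0 (tcoord i (foot u) v)].
Proof.
move=> iu; have Ou : O i (scmap i u) by exists u.
apply: filterS (near_line (row_mx 0 (tcoord i (foot u) v)) (@open_O i) Ou).
move=> t [u' iu' e]; exists u'.
have e' := e; rewrite !slit_cmapE scale_row_mx scaler0 add_row_mx addr0 in e'.
have [e1 e2] := eq_row_mx e'.
have ef : foot u' = foot u := atlas_inj hA iu' iu e1.
split; [by []| |exact: e].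
move: e2; rewrite ef [_ + _ *: _]addrC -tcoord_linear => e2.
by rewrite -(tcoordK hA (eta u') iu) e2 tcoordK // addrC.
Qed.
End SlitFields.

(** * The metric as the fibre Hessian of the energy *)

Section Metric.
Variables (R : realType) (n : nat) (M : Type) (A : atlas R n M).
Hypothesis hA : manifold_atlas A.
Variable L : M * 'rV[R]_n -> R.
Hypothesis hL : finsler A L.
Notation slit := (slit R n M).
Notation SA := (slit_atlas A).
Notation scmap i := (@cmap _ _ _ SA i).
Implicit Types (i j k : chart A) (u : slit) (X : vfield R n M) (U V Z : pifield R n M).
Let hS := slit_manifold_atlas hA.
Let O i := @cmap _ _ _ SA i @` @cdom _ _ _ SA i.

Definition energy u : R := 2^-1 * L (sval u) ^+ 2.

Lemma smooth_energy : smooth SA energy.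
Proof.
have sL := finsler_smooth hL.
apply: (smoothM hS); first exact: (smooth_cst hS).
by apply: (smoothM hS).
Qed.

Let E i := localrep (A := SA) i energy.

Lemma Cr_E i r : Cr r (O i) (E i).
Proof. exact: smooth_energy. Qed.

(** Two uses of [fibre_line], one for each variable, turn the iterated one-variable derivatives into
    iterated differentials of the local energy. The 2 in [G] appears because [L ^+ 2] is twice the
    energy, and the [2^-1] of [metric] removes it. *)
Lemma metricE i u v w : cdom i (foot u) -> metric L u v w =
  dif (fun z => dif (E i) z (row_mx 0 (tcoord i (foot u) w))) (scmap i u)
    (row_mx 0 (tcoord i (foot u) v)).
Proof.
move=> iu; rewrite /metric.
have Ou u' : cdom i (foot u') -> O i (scmap i u') by exists u'.
set w' := row_mx 0 (tcoord i (foot u) w); set v' := row_mx 0 (tcoord i (foot u) v).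
pose G z := 2 * dif (E i) z w'.
have inner : \forall s \near (0 : R),
    derive1 (fun t : R => L (foot u, eta u + s *: v + t *: w) ^+ 2) 0 =
    G (scmap i u + s *: v').
  apply: filterS (fibre_line hA v iu) => s [u' [fu' eu' <-]].
  have iu' : cdom i (foot u') by rewrite fu'.
  have d1 : dable (E i) (scmap i u') := Cr_dable (Cr_E i 1) (Ou _ iu').
  have dc : dable (fun=> 2 : R) (scmap i u') by exact: dable_cst.
  rewrite (derive1_line (F := fun z => 2 * E i z) (x := scmap i u') (v := w')).
  - by rewrite difM // dif_cst mulr0 addr0.
  - apply: filterS (fibre_line hA w iu') => t [u'' [fu'' eu'' e]].
    rewrite /w' -fu' -e /E localrep_slit //; last by rewrite fu''.
    rewrite /energy -eu' -fu'' -eu'' mulrA mulfV ?mul1r ?pnatr_eq0 //.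
    by rewrite /foot /eta -surjective_pairing.
  - exact: dableM.
have dE := Cr_dable (Cr_dif_cst w' (open_O hA (i := i)) (Cr_E i 2)) (Ou _ iu).
have dc : dable (fun=> 2 : R) (scmap i u) by exact: dable_cst.
have dG : dable G (scmap i u) by exact: dableM.
rewrite (derive1_line inner dG) /G difM // dif_cst mulr0 addr0 mulrA.
by rewrite mulVf ?mul1r ?pnatr_eq0.
Qed.

Lemma metricC u v w : metric L u v w = metric L u w v.
Proof.
have ku := atlas_chart_at hA (foot u).
rewrite !(metricE _ _ ku).
apply: (dif_schwarz _ _ (open_O hA (i := _)) (Cr_E _ 2)).
by exists u.
Qed.

Lemma metric_linear u w : linear (fun v => metric L u v w : R^o).
Proof.
have ku := atlas_chart_at hA (foot u) => a v v'.
rewrite !(metricE _ _ ku) tcoord_linear.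
set b := tcoord _ _ v; set b' := tcoord _ _ v'.
have -> : row_mx 0 (a *: b + b') = a *: row_mx 0 b + row_mx 0 b' :> 'rV[R]_(n + n).
  by rewrite scale_row_mx scaler0 add_row_mx addr0.
exact: dif_linear.
Qed.

Lemma Cr_metric i U V r : smooth_pifield A U -> smooth_pifield A V ->
  Cr r (O i) (localrep (A := SA) i (fun u => metric L u (U u) (V u))).
Proof.
move=> sU sV; have oO := open_O hA (i := i).
have c0 : Cr r (O i) (fun=> 0 : 'rV[R]_n) by exact: Cr_cst.
have cU := Cr_row_mx oO c0 (Cr_locpi i r sU).
have cV := Cr_row_mx oO c0 (Cr_locpi i r sV).
pose g z := row_mx (0 : 'rV[R]_n) (locpi i U z).
pose h z := row_mx (0 : 'rV[R]_n) (locpi i V z).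
(* The second direction is held fixed while differentiating, although [V] varies with the point.
   Expanding it in the standard basis leaves smooth coefficients times second derivatives of the
   energy in constant inner directions. *)
have c : Cr r (O i) (fun z => \sum_(l < n + n) h z 0 l *
    dif (fun z => dif (E i) z (delta_mx 0 l)) z (g z)).
  apply: Cr_sum => // l; apply: Cr_mul => //.
    exact: ((Cr_coordP _ _ oO).1 cV l).
  by apply: Cr_dif => //; apply: Cr_dif_cst => //; exact: Cr_E.
apply: (Cr_ext oO _ c) => _ [u iu <-].
rewrite localrep_slit // (metricE _ _ iu) /g /h !locpiE //.
set b := row_mx _ (tcoord i (foot u) (V u)); set a := row_mx _ _.
have -> : (fun z => dif (E i) z b) =
    (fun z => \sum_(l < n + n) b 0 l * dif (E i) z (delta_mx 0 l)).
  by apply/funext => z; rewrite dif_sum_coord.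
have Ou : O i (scmap i u) by exists u.
have dl l : dable (fun z => dif (E i) z (delta_mx 0 l)) (scmap i u).
  exact: Cr_dable (Cr_dif_cst _ oO (Cr_E i 2)) Ou.
have dcst (x : R) : dable (fun=> x) (scmap i u) by exact: dable_cst.
rewrite dif_sum => [|l]; last exact: dableM.
by apply: eq_bigr => l _; rewrite difM // dif_cst mulr0 addr0.
Qed.

Lemma smooth_metric U V : smooth_pifield A U -> smooth_pifield A V ->
  smooth SA (fun u => metric L u (U u) (V u)).
Proof. by move=> sU sV i r; exact: Cr_metric. Qed.
End Metric.

(** * Homogeneity of the energy and Euler's relation *)

Section Euler.
Variables (R : realType) (n : nat) (M : Type) (A : atlas R n M).
Hypothesis hA : manifold_atlas A.
Variable L : M * 'rV[R]_n -> R.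
Hypothesis hL : finsler A L.
Notation slit := (slit R n M).
Notation SA := (slit_atlas A).
Notation scmap i := (@cmap _ _ _ SA i).
Implicit Types (i j k : chart A) (u : slit) (X : vfield R n M) (U V Z : pifield R n M).
Let hS := slit_manifold_atlas hA.
Let O i := @cmap _ _ _ SA i @` @cdom _ _ _ SA i.
Let E i := localrep (A := SA) i (energy L).

Lemma energy_homogeneous u u' (l : R) : 0 < l ->
  foot u' = foot u -> eta u' = l *: eta u -> energy L u' = l ^+ 2 * energy L u.
Proof.
move=> l0; rewrite /energy /foot /eta => e1 e2.
rewrite (surjective_pairing (sval u')) e1 e2 (finsler_homogeneous hL) //.
by rewrite exprMn mulrCA -surjective_pairing.
Qed.

(** The curve [phi] is read in two ways: as a line through [u'] in the direction [l *: w'], with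
    derivative [l dE(u')], and as the dilation by [l] of the line through [u] in the direction [w'],
    with derivative [l^2 dE(u)]. Cancelling one [l] leaves degree one. *)
Lemma dif_energy_homogeneous i u u' (l : R) (w : 'rV[R]_n) : 0 < l ->
  cdom i (foot u) -> foot u' = foot u -> eta u' = l *: eta u ->
  dif (E i) (scmap i u') (row_mx 0 (tcoord i (foot u) w)) =
  l * dif (E i) (scmap i u) (row_mx 0 (tcoord i (foot u) w)).
Proof.
move=> l0 iu fu' eu'; have iu' : cdom i (foot u') by rewrite fu'.
set w' := row_mx 0 _.
have dE q : cdom i (foot q) -> dable (E i) (scmap i q).
  by move=> iq; apply: (Cr_dable (Cr_E hA hL i 1)); exists q.
pose phi t := E i (scmap i u' + t *: (l *: w')).
have phi1 : derive1 phi 0 = l * dif (E i) (scmap i u') w'.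
  rewrite -[RHS]difZr; apply: derive1_line (dE _ iu').
  exact: filterE.
have dc : dable (fun=> l ^+ 2 : R) (scmap i u) by exact: dable_cst.
have phi2 : derive1 phi 0 = l ^+ 2 * dif (E i) (scmap i u) w'.
  have -> : l ^+ 2 * dif (E i) (scmap i u) w' =
      dif (fun z => l ^+ 2 * E i z) (scmap i u) w'.
    by rewrite difM ?dif_cst ?mulr0 ?addr0 //; exact: dE.
  apply: derive1_line (dableM dc (dE _ iu)).
  apply: filterS2 (fibre_line hA w iu) (fibre_line hA (l *: w) iu').
  move=> t [q [fq eq cq]] [q' [fq' eq' cq']].
  rewrite /phi /w' -cq.
  have -> : scmap i u' + t *: (l *: row_mx 0 (tcoord i (foot u) w)) = scmap i q'.
    rewrite cq' fu' -[l *: w]addr0 tcoord_linear tcoord0 addr0.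
    by rewrite [l *: row_mx _ _]scale_row_mx scaler0.
  rewrite /E !localrep_slit ?fq ?fq' ?fu' //.
  apply: energy_homogeneous => //; first by rewrite fq' fq.
  by rewrite eq' eq eu' scalerDr !scalerA mulrC.
have l0' : l != 0 by rewrite gt_eqF.
apply: (mulfI l0'); rewrite -phi1 phi2 expr2; exact: esym (mulrA _ _ _).
Qed.

(** Moving by [h] along [eta u] multiplies the vector by [1 + h], so by homogeneity of degree one
    the fibre differential of the energy is affine in [h], with slope its own value at [u]. *)
Lemma metric_etaE i u w : cdom i (foot u) -> metric L u (eta u) w =
  dif (E i) (scmap i u) (row_mx 0 (tcoord i (foot u) w)).
Proof.
move=> iu; rewrite (metricE hA hL _ _ iu).
set w' := row_mx 0 (tcoord i (foot u) w).
have Ou : O i (scmap i u) by exists u.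
rewrite difE; last first.
  exact: Cr_dable (Cr_dif_cst w' (open_O hA (i := i)) (Cr_E hA hL i 2)) Ou.
apply: derive_affine.
(* Homogeneity is available for positive factors only. *)
have pos : \forall h \near (0 : R), 0 < 1 + h.
  have : \forall h \near (0 : R), -1 < h by by apply: lt_nbhsr; rewrite oppr_lt0.
  by apply: filterS => h; rewrite -subr_gt0 opprK addrC.
apply: filterS2 pos (fibre_line hA (eta u) iu) => h h0 [u' [fu' eu' <-]].
rewrite /w' (dif_energy_homogeneous w h0 iu fu') ?mulrDl ?mul1r //.
by rewrite eu' scalerDl scale1r.
Qed.

Lemma metric_eta Z u : metric L u (eta u) (Z u) = fderiv SA (gamma A Z) (energy L) u.
Proof.
have ku := atlas_chart_at hA (foot u).
by rewrite (metric_etaE _ ku) fderivE gammaE // tcoord_id.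
Qed.

(** With [Z = rho X], the left side is the iterated derivative of the energy along [gamma Z] and
    then [gamma U]. Its second-order part is [g(U, Z)]. Its first-order part is [dE] on the vertical
    derivative of [Z], which is [rho] of the bracket by [rho_lie_gamma], and [dE] is again
    [g(eta, _)]. *)
Lemma euler_identity U X u : smooth_pifield A U -> smooth_field SA X ->
  fderiv SA (gamma A U) (fun u => metric L u (eta u) (rho A X u)) u =
  metric L u (U u) (rho A X u)
  + metric L u (eta u) (rho A (lie SA (gamma A U) X) u).
Proof.
move=> sU sX; set Z := rho A X; have sZ : smooth_pifield A Z := smooth_rho hA sX.
have -> : (fun u => metric L u (eta u) (Z u)) = fderiv SA (gamma A Z) (energy L).
  by apply/funext => q; rewrite metric_eta.
have ku := atlas_chart_at hA (foot u).
have sgZ := smooth_gamma hA sZ; have sE := smooth_energy hA hL.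
rewrite fderivE (rho_lie_gamma hA u sU sX).
have -> : @chart_at _ _ _ SA u = chart_at A (foot u) by [].
set k := chart_at A (foot u) in ku *.
have Ou : O k (scmap k u) by exists u.
have dz : dable (locfield (B := SA) k (gamma A Z)) (scmap k u).
  exact: (@field_dable _ _ _ SA _ k u sgZ ku).
have oO := open_O hA (i := k).
have n1 : \forall y \near scmap k u,
    lder (locfield (B := SA) k (gamma A Z)) (E k) y =
    localrep (A := SA) k (fderiv SA (gamma A Z) (energy L)) y.
  apply: filterS (nbhs_O hA ku) => _ [q kq ->].
  by rewrite (localrep_fderiv hS _ sE (p := q)).
have dl : dable (lder (locfield (B := SA) k (gamma A Z)) (E k)) (scmap k u).
  exact: Cr_dable (Cr_lder oO (Cr_E hA hL k 2) (@Cr_locfield _ _ _ SA k _ 1 sgZ)) Ou.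
rewrite -(dif_near _ n1 dl) (dif_lder _ oO (Cr_E hA hL k 2) dz Ou).
rewrite gammaE // (metricE hA hL _ _ ku) !(metric_etaE _ ku) !tcoord_id //.
rewrite locfield_gamma // locpiE // tcoord_id //; congr (_ + dif _ _ _).
have lr : linear (fun b : 'rV[R]_n => row_mx 0 b : 'rV[R]_(n + n)).
  by move=> a v w; rewrite scale_row_mx scaler0 add_row_mx addr0.
rewrite -(dif_linfun_comp _ lr (pifield_dable sZ ku)).
apply: dif_near => //.
apply: filterS (nbhs_O hA ku) => _ [q kq ->].
by rewrite locfield_gamma.
Qed.
End Euler.

(** * Expansion in a frame by Cramer's rule *)

Section FrameExpansion.
Variables (F : fieldType) (n : nat).

(* Cramer's rule for the Gram matrix; the factor \det makes the identity valid
   also where the rows of B are dependent. *)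
Lemma gram_expansion (g B : 'M[F]_n) (y : 'rV[F]_n) :
  let G := B *m g *m B^T in
  (\det G) ^+ 2 *: y =
  (\det G *: (\adj G *m (B *m g *m y^T)))^T *m B.
Proof.
move=> G; have [G0|G0] := eqVneq (\det G) 0.
  by rewrite G0 expr0n scale0r scale0r trmx0 mul0mx.
have uB : B \in unitmx.
  rewrite unitmxE unitfE; apply: contra_neq G0 => B0.
  by rewrite !det_mulmx B0 !mul0r.
rewrite -{1 2}[y](mulmxKV uB); set z := y *m invmx B.
rewrite trmx_mul -mulmxA -/G.
have -> : B *m (g *m (B^T *m z^T)) = G *m z^T by rewrite /G !mulmxA.
rewrite (mulmxA (\adj G)) mul_adj_mx mul_scalar_mx scalerA -expr2.
by rewrite linearZ /= trmxK -scalemxAl.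
Qed.
End FrameExpansion.

(** * Tensoriality of the connection and smoothness of [beta] *)

Section Connection.
Variables (R : realType) (n : nat) (M : Type) (A : atlas R n M).
Hypothesis hA : manifold_atlas A.
Variable L : M * 'rV[R]_n -> R.
Hypothesis hL : finsler A L.
Variable D : vfield R n M -> pifield R n M -> pifield R n M.
Hypothesis hD : cartan_connection A D L.
Notation slit := (slit R n M).
Notation SA := (slit_atlas A).
Notation vfield := (vfield R n M).
Notation pifield := (pifield R n M).
Implicit Types (u : slit) (X Y : vfield) (U V Z : pifield).
Let hS := slit_manifold_atlas hA.
Let hC := cartan_linear hD.
Notation sf := (smooth_field SA).
Notation spi := (smooth_pifield A).

Let lcS (i : chart SA) u : linear (@tcoord _ _ _ SA i u) := tcoord_linear i u.
Let lcA (i : chart SA) u : linear (@tcoord R n M A i (foot u)) :=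
  tcoord_linear (i : chart A) (foot u).

Lemma smooth_fieldD X Y : sf X -> sf Y -> sf (X \+ Y).
Proof. exact: (smooth_sectionD hS lcS). Qed.
Lemma smooth_fieldZ (f : slit -> R) X : smooth SA f -> sf X -> sf (fun u => f u *: X u).
Proof. exact: (smooth_sectionZ hS lcS). Qed.
Lemma smooth_field0 : sf (fun=> 0).
Proof. exact: (smooth_section0 hS lcS). Qed.
Lemma smooth_field_sum (I : Type) (s : seq I) (X : I -> vfield) : (forall i, sf (X i)) ->
  sf (fun u => \sum_(i <- s) X i u).
Proof. exact: (smooth_section_sum hS lcS). Qed.
Lemma smooth_field_local X : (forall u, exists2 h : slit -> R, smooth SA h /\ h u != 0 &
  sf (fun q => h q *: X q)) -> sf X.
Proof. exact: (smooth_section_local hS lcS). Qed.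
Lemma smooth_pifieldD U V : spi U -> spi V -> spi (U \+ V).
Proof. exact: (smooth_sectionD hS lcA). Qed.
Lemma smooth_pifieldZ (f : slit -> R) U : smooth SA f -> spi U -> spi (fun u => f u *: U u).
Proof. exact: (smooth_sectionZ hS lcA). Qed.
Lemma smooth_pifield0 : spi (fun=> 0).
Proof. exact: (smooth_section0 hS lcA). Qed.
Lemma smooth_pifield_sum (I : Type) (s : seq I) (U : I -> pifield) : (forall i, spi (U i)) ->
  spi (fun u => \sum_(i <- s) U i u).
Proof. exact: (smooth_section_sum hS lcA). Qed.
Let scst (a : R) : smooth SA (fun=> a) := smooth_cst hS a.
Lemma smooth_fieldN X : sf X -> sf (fun u => - X u).
Proof.
move=> sX; have -> : (fun u => - X u) = (fun u => -1 *: X u).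
  by apply/funext => u; rewrite scaleN1r.
exact: smooth_fieldZ.
Qed.
Lemma smooth_pifieldN U : spi U -> spi (fun u => - U u).
Proof.
move=> sU; have -> : (fun u => - U u) = (fun u => -1 *: U u).
  by apply/funext => u; rewrite scaleN1r.
exact: smooth_pifieldZ.
Qed.

Lemma connection0l U : spi U -> D (fun=> 0) U = fun=> 0.
Proof.
move=> sU; have -> : (fun=> 0) = (fun u => 0 *: (0 : 'rV[R]_(n + n))) :> vfield.
  by apply/funext => u; rewrite scaler0.
rewrite (connection_scalel hC (f := fun=> 0)) //; last exact: smooth_field0.
by apply/funext => u; rewrite scale0r.
Qed.

Lemma connection0r X : sf X -> D X (fun=> 0) = fun=> 0.
Proof.
move=> sX; have := connection_addr hC sX smooth_pifield0 smooth_pifield0.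
have -> : (fun=> 0) \+ (fun=> 0) = (fun=> 0) :> pifield.
  by apply/funext => u; rewrite /= addr0.
move=> /(congr1 (fun f : pifield => f - D X (fun=> 0))).
by rewrite addrK subrr => <-.
Qed.

Lemma connectionNl X U : sf X -> spi U -> D (fun u => - X u) U = fun u => - D X U u.
Proof.
move=> sX sU; have -> : (fun u => - X u) = (fun u => -1 *: X u).
  by apply/funext => u; rewrite scaleN1r.
rewrite (connection_scalel hC (f := fun=> -1)) //.
by apply/funext => u; rewrite scaleN1r.
Qed.

Lemma connection_sum (I : Type) (s : seq I) (X : I -> vfield) U u : spi U ->
  (forall i, sf (X i)) ->
  D (fun u => \sum_(i <- s) X i u) U u = \sum_(i <- s) D (X i) U u.
Proof.
move=> sU sX; elim: s => [|i s IH].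
  have -> : (fun u => \sum_(i <- [::]) X i u) = fun=> 0.
    by apply/funext => q; rewrite big_nil.
  by rewrite connection0l // big_nil.
have -> : (fun u => \sum_(j <- i :: s) X j u) = X i \+ (fun u => \sum_(j <- s) X j u).
  by apply/funext => q; rewrite big_cons.
by rewrite (connection_addl hC) //= ?IH ?big_cons //; exact: smooth_field_sum.
Qed.

Lemma connection_lincomb (c : 'I_n -> slit -> R) (X : 'I_n -> vfield) U u : spi U ->
  (forall a, smooth SA (c a)) -> (forall a, sf (X a)) ->
  D (fun u => \sum_a c a u *: X a u) U u = \sum_a c a u *: D (X a) U u.
Proof.
move=> sU sc sX; rewrite (connection_sum _ (X := fun a u => c a u *: X a u)) //.
  by apply: eq_bigr => a _; rewrite (connection_scalel hC).
by move=> a; exact: smooth_fieldZ.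
Qed.

Section Frame.
Variable Y : 'I_n -> pifield.
Hypothesis sY : forall a, spi (Y a).

Let gram u : 'M[R]_n := \matrix_(a, b) metric L u (Y a u) (Y b u).
(** The factor of [gram_expansion]: a global smooth function, nonzero wherever the [Y a] are
    independent. *)
Definition frame_det u : R := (\det (gram u)) ^+ 2.
Definition frame_coef Z (a : 'I_n) u : R :=
  \det (gram u) * \sum_b (\adj (gram u)) a b * metric L u (Y b u) (Z u).

Let smooth_gram a b : smooth SA (fun u => gram u a b).
Proof.
apply: smooth_ext (smooth_metric hA hL (sY a) (sY b)) => u.
by rewrite mxE.
Qed.

Lemma smooth_frame_det : smooth SA frame_det.
Proof. by apply: (smoothM hS); exact: (smooth_det hS). Qed.

Lemma smooth_frame_coef Z a : spi Z -> smooth SA (frame_coef Z a).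
Proof.
move=> sZ; apply: (smoothM hS); first exact: (smooth_det hS).
apply: (smooth_sum hS) => b; apply: (smoothM hS).
  exact: (smooth_adj hS).
exact: (smooth_metric hA hL).
Qed.

Let gmat u : 'M[R]_n := \matrix_(k, l) metric L u (delta_mx 0 k) (delta_mx 0 l).

Let metricDl u w (v v' : 'rV[R]_n) (a : R) :
  metric L u (a *: v + v') w = a * metric L u v w + metric L u v' w.
Proof. exact: (metric_linear hA hL). Qed.

Let metric_mx u (v w : 'rV[R]_n) : metric L u v w = (v *m gmat u *m w^T) 0 0.
Proof.
have lin (f : 'rV[R]_n -> R) : (forall a x y, f (a *: x + y) = a * f x + f y) ->
    forall x, f x = \sum_k x 0 k * f (delta_mx 0 k).
  move=> lf x; have f0 : f 0 = 0.
    by have := lf (-1) 0 0; rewrite scaler0 addr0 mulN1r addNr.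
  rewrite [in LHS](row_sum_delta x).
  elim: (index_enum _) => [|k s IH]; first by rewrite !big_nil.
  by rewrite !big_cons lf IH.
rewrite (lin (fun v => metric L u v w)); last by move=> a x y; exact: metricDl.
rewrite -mulmxA mxE; apply: eq_bigr => k _; congr (_ * _).
rewrite (metricC hA hL) (lin (fun v => metric L u v (delta_mx 0 k))); last first.
  by move=> a x y; exact: metricDl.
rewrite mxE; apply: eq_bigr => l _.
by rewrite !mxE mulrC (metricC hA hL).
Qed.

Let fmat u : 'M[R]_n := \matrix_a Y a u.

Let metric_row u a (w : 'rV[R]_n) :
  metric L u (Y a u) w = (fmat u *m gmat u *m w^T) a 0.
Proof.
by rewrite metric_mx -[Y a u](rowK (fun a => Y a u)) -!row_mul mxE.
Qed.

Let gramE u : gram u = fmat u *m gmat u *m (fmat u)^T.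
Proof.
apply/matrixP => a b; rewrite mxE metric_row !mxE.
by apply: eq_bigr => j _; rewrite !mxE.
Qed.

Lemma frame_expand Z u : frame_det u *: Z u = \sum_a frame_coef Z a u *: Y a u.
Proof.
rewrite /frame_det gramE gram_expansion -gramE.
rewrite mulmx_sum_row; apply: eq_bigr => a _; rewrite rowK; congr (_ *: _).
rewrite !mxE; congr (_ * _).
by apply: eq_bigr => b _; rewrite metric_row.
Qed.

(** A null vector of the Gram matrix gives a combination of the [Y a u] of zero length; by positive
    definiteness the combination is zero, against independence. *)
Lemma frame_det_neq0 u :
  (forall x : 'rV[R]_n, \sum_a x 0 a *: Y a u = 0 -> x = 0) -> frame_det u != 0.
Proof.
move=> free; rewrite expf_neq0 //; apply/negP => /det0P[x x0 xG].
have e : \sum_a x 0 a *: Y a u = x *m fmat u.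
  by rewrite mulmx_sum_row; apply: eq_bigr => a _; rewrite rowK.
have yx : x *m fmat u != 0 by rewrite -e; apply: contra_neq x0; exact: free.
have := finsler_posdef hL u yx; rewrite metric_mx trmx_mul !mulmxA.
have -> : x *m fmat u *m gmat u *m (fmat u)^T = x *m gram u by rewrite gramE !mulmxA.
by rewrite xG mul0mx mxE ltxx.
Qed.

Lemma frame_coef0 Z a u : Z u = 0 -> frame_coef Z a u = 0.
Proof.
move=> Z0; rewrite /frame_coef big1 ?mulr0 // => b _.
have -> : metric L u (Y b u) (Z u) = 0 by rewrite Z0 metric_mx trmx0 mulmx0 mxE.
by rewrite mulr0.
Qed.
End Frame.

Lemma horizontal_sub u w w' : horizontal A D u w -> horizontal A D u w' ->
  horizontal A D u (w - w').
Proof.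
move=> [X [sX <- KX]] [X' [sX' <- KX']].
exists (X \+ (fun u => - X' u)); split => //.
  by apply: smooth_fieldD => //; exact: smooth_fieldN.
rewrite /Kmap (connection_addl hC) //; last 2 first.
- exact: smooth_fieldN.
- exact: (smooth_eta hA).
rewrite connectionNl //; last exact: (smooth_eta hA).
by rewrite -[D X _]/(Kmap D X) -[D X' _]/(Kmap D X') /= KX KX' subr0.
Qed.

Lemma horizontal_scale u a w : horizontal A D u w -> horizontal A D u (a *: w).
Proof.
move=> [X [sX <- KX]]; exists (fun u => a *: X u); split => //; first exact: smooth_fieldZ.
rewrite /Kmap (connection_scalel hC (f := fun=> a)) //; last exact: (smooth_eta hA).
by rewrite -[D X _]/(Kmap D X) KX scaler0.
Qed.

Lemma horizontal_inj u w w' : horizontal A D u w -> horizontal A D u w' ->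
  lsubmx w = lsubmx w' -> w = w'.
Proof.
move=> hw hw' e; have [_ vh] := cartan_regular hD u.
have : (vertical A u `&` horizontal A D u) (w - w').
  split; last exact: horizontal_sub.
  by rewrite /vertical /= dpiE // linearB /= e subrr.
by rewrite vh => /eqP; rewrite subr_eq0 => /eqP.
Qed.

Lemma horizontal_lift u (x : 'rV[R]_n) :
  exists2 w, horizontal A D u w & lsubmx w = x.
Proof.
have [split_u _] := cartan_regular hD u.
have [v [h [hv hh e]]] := split_u (row_mx x 0); exists h => //.
have := congr1 (@lsubmx _ 1 n n) e; rewrite row_mxKl linearD /=.
move: hv; rewrite /vertical /= dpiE // => -> ->.
by rewrite add0r.
Qed.

Lemma beta_spec Z u : horizontal A D u (beta A D Z u) /\ lsubmx (beta A D Z u) = Z u.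
Proof.
rewrite /beta; case: xgetP => [w _ [hw]|h]; first by rewrite dpiE.
have [w hw e] := horizontal_lift u (Z u).
by case: (h w); split=> //; rewrite dpiE.
Qed.

(** Regularity leaves the choice in [beta] a single candidate. Linearity of [beta], and its
    comparison with explicitly constructed horizontal fields, are drawn from this. *)
Lemma beta_unique Z u w : horizontal A D u w -> lsubmx w = Z u -> beta A D Z u = w.
Proof.
move=> hw e; have [hb eb] := beta_spec Z u.
exact: (horizontal_inj hb hw (etrans eb (esym e))).
Qed.

Lemma rho_beta Z : rho A (beta A D Z) = Z.
Proof. by apply/funext => u; rewrite rhoE //; have [] := beta_spec Z u. Qed.

Lemma beta_scale (h : slit -> R) Z u :
  beta A D (fun u => h u *: Z u) u = h u *: beta A D Z u.
Proof.
have [hb eb] := beta_spec Z u; apply: beta_unique.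
  exact: horizontal_scale.
by rewrite linearZ /= eb.
Qed.

Lemma betaD Z Z' u : beta A D (Z \+ Z') u = beta A D Z u + beta A D Z' u.
Proof.
have [hb eb] := beta_spec Z u; have [hb' eb'] := beta_spec Z' u.
apply: beta_unique; last by rewrite linearD /= eb eb'.
rewrite -[beta A D Z' u]opprK; apply: horizontal_sub => //.
by rewrite -scaleN1r; exact: horizontal_scale.
Qed.

Lemma Kmap0_beta X : sf X -> (forall u, Kmap D X u = 0) -> beta A D (rho A X) = X.
Proof.
move=> sX KX; apply/funext => u; apply: beta_unique; last by rewrite rhoE.
by exists X.
Qed.

Lemma horizontal_frame u : exists X : 'I_n -> vfield,
  (forall a, sf (X a)) /\ (forall a, rho A (X a) u = delta_mx 0 a).
Proof.
have ex a : exists X : vfield, sf X /\ rho A X u = delta_mx 0 a.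
  have [w [X [sX Xu _]] e] := horizontal_lift u (delta_mx 0 a).
  by exists X; split=> //; rewrite rhoE // Xu.
have [X hX] := choice ex; exists X; split=> a; by have [] := hX a.
Qed.

Lemma delta_free (Y : 'I_n -> pifield) u : (forall a, Y a u = delta_mx 0 a) ->
  forall x : 'rV[R]_n, \sum_a x 0 a *: Y a u = 0 -> x = 0.
Proof.
move=> eY x <-; rewrite [LHS]row_sum_delta.
by apply: eq_bigr => a _; rewrite eY.
Qed.

Lemma gamma_lincomb (c : 'I_n -> slit -> R) (Y : 'I_n -> pifield) :
  gamma A (fun u => \sum_a c a u *: Y a u) =
  fun u => \sum_a c a u *: gamma A (Y a) u.
Proof.
apply/funext => u; rewrite gammaE //.
elim: (index_enum _) => [|a s IH]; first by rewrite !big_nil row_mx0.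
by rewrite !big_cons -IH gammaE // scale_row_mx scaler0 add_row_mx add0r.
Qed.

Lemma rho_lincomb (c : 'I_n -> slit -> R) (X : 'I_n -> vfield) :
  rho A (fun u => \sum_a c a u *: X a u) =
  fun u => \sum_a c a u *: rho A (X a) u.
Proof.
apply/funext => u; rewrite rhoE // linear_sum.
by apply: eq_bigr => a _; rewrite linearZ /= rhoE.
Qed.

(* No bump functions are needed: regularity provides a frame at u made of global
   fields, and Cramer's rule expands a multiple of any field in it globally. *)
Lemma connection_gamma_tensorial V U u : spi V -> spi U -> V u = 0 -> D (gamma A V) U u = 0.
Proof.
move=> sV sU V0; have [X [sX eX]] := horizontal_frame u.
pose Y a := rho A (X a); have sY a : spi (Y a) := smooth_rho hA (sX a).
have h0 := frame_det_neq0 (delta_free (Y := Y) eX).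
have sh := smooth_frame_det sY.
have e : (fun q => frame_det Y q *: gamma A V q) =
    fun q => \sum_a frame_coef Y V a q *: gamma A (Y a) q.
  rewrite -gamma_lincomb; apply/funext => q.
  rewrite [RHS]gammaE // -frame_expand gammaE //.
  by rewrite scale_row_mx scaler0.
have sgV := smooth_gamma hA sV.
have eD := connection_lincomb u sU (fun a => smooth_frame_coef sY a sV)
  (fun a => smooth_gamma hA (sY a)).
have := congr1 (fun X => D X U u) e; rewrite /= (connection_scalel hC sh sgV sU) eD.
rewrite big1 => [/eqP|a _]; last by rewrite frame_coef0 // scale0r.
by rewrite scaler_eq0 (negPf h0) => /eqP.
Qed.

(** A multiple of [X] differs from a combination of the frame fields, with coefficients vanishing at
    [u], by a field with zero projection. That remainder is [gamma V] with [V u = 0], the case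
    already settled. *)
Lemma connection_tensorial X U u : sf X -> spi U -> X u = 0 -> D X U u = 0.
Proof.
move=> sX sU X0; have [F [sF eF]] := horizontal_frame u.
pose Y a := rho A (F a); have sY a : spi (Y a) := smooth_rho hA (sF a).
have h0 := frame_det_neq0 (delta_free (Y := Y) eF).
have sh := smooth_frame_det sY.
have sZ := smooth_rho hA sX.
have sc a := smooth_frame_coef sY a sZ.
have c0 a : frame_coef Y (rho A X) a u = 0.
  by apply: frame_coef0; rewrite rhoE // X0 linear0.
pose S q := \sum_a frame_coef Y (rho A X) a q *: F a q.
have sS : sf S by apply: smooth_field_sum => a; exact: smooth_fieldZ.
pose W := (fun q => frame_det Y q *: X q) \+ (fun q => - S q).
have shX : sf (fun q => frame_det Y q *: X q) by exact: smooth_fieldZ.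
have sW : sf W by apply: smooth_fieldD => //; exact: smooth_fieldN.
have [q|V sV eW] := vertical_field hA sW.
  rewrite rhoE // /W /= linearB linearZ /= -[lsubmx (S q)](rhoE hA).
  by rewrite rho_lincomb -frame_expand rhoE // subrr.
have V0 : V u = 0.
  have Wu : W u = 0.
    by rewrite /W /= X0 scaler0 sub0r /S big1 ?oppr0 // => a _; rewrite c0 scale0r.
  move: Wu; rewrite eW gammaE // => /(congr1 (@rsubmx _ 1 n n)).
  by rewrite row_mxKr linear0.
have e : (fun q => frame_det Y q *: X q) = gamma A V \+ S.
  by rewrite -eW; apply/funext => q; rewrite /W /= subrK.
have eD : D S U u = _ := connection_lincomb u sU sc sF.
have := congr1 (fun X => D X U u) e; rewrite /= (connection_scalel hC sh sX sU).
rewrite (connection_addl hC (smooth_gamma hA sV) sS sU) /=.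
rewrite (connection_gamma_tensorial sV sU V0) eD add0r.
rewrite big1 => [/eqP|a _]; last by rewrite c0 scale0r.
by rewrite scaler_eq0 (negPf h0) => /eqP.
Qed.

Lemma Kmap_gamma_inj V u : spi V -> Kmap D (gamma A V) u = 0 -> V u = 0.
Proof.
move=> sV KV; have [_ vh] := cartan_regular hD u.
have : (vertical A u `&` horizontal A D u) (gamma A V u).
  split; first by rewrite /vertical /= dpiE // gammaE // row_mxKl.
  by exists (gamma A V); split=> //; exact: (smooth_gamma hA).
rewrite vh gammaE // => /(congr1 (@rsubmx _ 1 n n)).
by rewrite row_mxKr linear0.
Qed.

Lemma smooth_Kmap X : sf X -> spi (Kmap D X).
Proof. by move=> sX; apply: (connection_smooth hC) => //; exact: (smooth_eta hA). Qed.

(* If [S] lifts a multiple of [Z], subtracting from a multiple of [S] the vertical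
   field with the same image under [Kmap] gives a smooth multiple of [beta Z]. *)
Lemma smooth_beta Z : spi Z -> sf (beta A D Z).
Proof.
move=> sZ; apply: smooth_field_local => u; have se := smooth_eta hA.
have [F [sF eF]] := horizontal_frame u.
pose Y a := rho A (F a); have sY a : spi (Y a) := smooth_rho hA (sF a).
have h0 := frame_det_neq0 (delta_free (Y := Y) eF).
have sgY a : sf (gamma A (Y a)) := smooth_gamma hA (sY a).
pose N a := Kmap D (gamma A (Y a)).
have sN a : spi (N a) by exact: smooth_Kmap.
(* By regularity no nonzero vertical vector is killed by [Kmap], so the images under [Kmap] of a
   vertical frame at [u] are independent there. *)
have freeN (x : 'rV[R]_n) : \sum_a x 0 a *: N a u = 0 -> x = 0.
  rewrite -(connection_lincomb (c := fun a _ => x 0 a) u se (fun a => scst (x 0 a)) sgY).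
  rewrite -gamma_lincomb => K0.
  apply: (delta_free (Y := Y) eF); apply: (Kmap_gamma_inj _ K0).
  by apply: smooth_pifield_sum => a; exact: (smooth_pifieldZ (f := fun=> x 0 a)).
have h0' := frame_det_neq0 freeN.
pose S q := \sum_a frame_coef Y Z a q *: F a q.
have sS : sf S.
  by apply: smooth_field_sum => a; apply: smooth_fieldZ => //; exact: smooth_frame_coef.
have sKS := smooth_Kmap sS.
(* Coefficients taken in the frame [N], vectors in the frame [Y]: since [Kmap] sends [gamma (Y a)]
   to [N a], it sends [gamma V] to [frame_det N] times [Kmap S]. *)
pose V q := \sum_a frame_coef N (Kmap D S) a q *: Y a q.
have sc a := smooth_frame_coef sN a sKS.
have sV : spi V by apply: smooth_pifield_sum => a; exact: smooth_pifieldZ.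
have sgV := smooth_gamma hA sV.
have sh := smooth_frame_det sY; have sh' := smooth_frame_det sN.
pose H := (fun q => frame_det N q *: S q) \+ (fun q => - gamma A V q).
have shS : sf (fun q => frame_det N q *: S q) by exact: smooth_fieldZ.
have sH : sf H by apply: smooth_fieldD => //; exact: smooth_fieldN.
have KH q : Kmap D H q = 0.
  have eD := connection_lincomb q se sc sgY.
  rewrite /Kmap (connection_addl hC shS (smooth_fieldN sgV) se) connectionNl //=.
  rewrite (connection_scalel hC sh' sS se) -[D S _]/(Kmap D S) frame_expand.
  by rewrite gamma_lincomb eD subrr.
have rH : rho A H = fun q => frame_det N q *: (frame_det Y q *: Z q).
  apply/funext => q; rewrite rhoE // /H /= linearB linearZ /= -[lsubmx (S q)](rhoE hA).
  by rewrite rho_lincomb -frame_expand gammaE // row_mxKl subr0.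
exists (fun q => frame_det N q * frame_det Y q).
  split; [exact: (smoothM hS sh' sh)|exact: (mulf_neq0 h0' h0)].
(* [H] is horizontal everywhere, hence it is the lift of its own projection, a multiple of [Z]. *)
have -> : (fun q => frame_det N q * frame_det Y q *: beta A D Z q) = H; last exact: sH.
apply/funext => q; rewrite -(Kmap0_beta sH KH) rH.
by rewrite (beta_scale (frame_det N)) (beta_scale (frame_det Y)) scalerA.
Qed.

(** The field witnessing that [beta Z] is horizontal at [u] varies with [u]. It agrees with [beta Z]
    at [u], and tensoriality transfers the vanishing of [Kmap]. *)
Lemma Kmap_beta Z u : spi Z -> Kmap D (beta A D Z) u = 0.
Proof.
move=> sZ; have [[X [sX eX KX]] _] := beta_spec Z u.
have sb := smooth_beta sZ; have se := smooth_eta hA.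
have : D (beta A D Z \+ (fun q => - X q)) (@eta R n M) u = 0.
  apply: connection_tensorial => //; last by rewrite /= eX subrr.
  by apply: smooth_fieldD => //; exact: smooth_fieldN.
rewrite (connection_addl hC sb (smooth_fieldN sX) se).
by rewrite connectionNl //= -[D X _]/(Kmap D X) KX subr0.
Qed.
End Connection.

(** * The curvature identities, from additive laws alone *)

Section Algebraic.
Variables (X E F : zmodType) (R : realDomainType) (I : Type) (ev : I -> F -> R).
Variables (br : X -> X -> X) (D : X -> E -> E) (act : X -> F -> F).
Variables (rho : X -> E) (gam bet : E -> X) (g : E -> E -> F) (eta : E).

(* The additive identities that the Cartan connection satisfies on smooth
   fields: [X] stands for vector fields, [E] for pi-vector fields, [F] for
   functions, which [ev] evaluates at points.  [ca_euler] encodes the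
   homogeneity of the energy. *)
Record cartan_algebra : Prop := CartanAlgebra {
  ca_brDl : forall x y z, br (x + y) z = br x z + br y z;
  ca_brC : forall x y, br x y = - br y x;
  ca_jacobi : forall x y z, br x (br y z) + br y (br z x) + br z (br x y) = 0;
  ca_DDl : forall x y a, D (x + y) a = D x a + D y a;
  ca_DDr : forall x a b, D x (a + b) = D x a + D x b;
  ca_actDl : forall x y f, act (x + y) f = act x f + act y f;
  ca_actDr : forall x f h, act x (f + h) = act x f + act x h;
  ca_act_br : forall x y f, act (br x y) f = act x (act y f) - act y (act x f);
  ca_rhoD : forall x y, rho (x + y) = rho x + rho y;
  ca_gamD : forall a b, gam (a + b) = gam a + gam b;
  ca_betD : forall a b, bet (a + b) = bet a + bet b;
  ca_rho_gam : forall a, rho (gam a) = 0;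
  ca_rho_bet : forall a, rho (bet a) = a;
  ca_ker_rho : forall x, rho x = 0 -> exists a, x = gam a;
  ca_D_bet_eta : forall a, D (bet a) eta = 0;
  ca_br_gam : forall a b, rho (br (gam a) (gam b)) = 0;
  ca_br_gam_eta : forall a x, rho x = eta -> rho (br (gam a) x) = a;
  ca_gDl : forall a b c, g (a + b) c = g a c + g b c;
  ca_gC : forall a b, g a b = g b a;
  ca_g_eq0 : forall a, g a a = 0 -> a = 0;
  ca_evD : forall i f h, ev i (f + h) = ev i f + ev i h;
  ca_ev_inj : forall f h, (forall i, ev i f = ev i h) -> f = h;
  ca_metric : forall x a b, act x (g a b) = g (D x a) b + g a (D x b);
  ca_Q : forall a b, D (bet a) b - D (bet b) a - rho (br (bet a) (bet b)) = 0;
  ca_T : forall a b c,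
    g (D (gam a) b - rho (br (gam a) (bet b))) c =
    g (D (gam a) c - rho (br (gam a) (bet c))) b;
  ca_euler : forall a x,
    act (gam a) (g eta (rho x)) = g a (rho x) + g eta (rho (br (gam a) x)) }.

Hypothesis ca : cartan_algebra.

(* Locked, so that rewriting with additivity does not look inside. *)
Definition mtor a b := locked (D (gam a) b - rho (br (gam a) (bet b))).
Definition curv x y z := locked (- D x (D y z) + D y (D x z) + D (br x y) z).
Definition tor x y := locked (D x (rho y) - D y (rho x) - rho (br x y)).

Lemma additive_fun0 (U V : zmodType) (f : U -> V) :
  {morph f : a b / a + b} -> f 0 = 0.
Proof. by move=> fD; apply: (addIr (f 0)); rewrite -fD !add0r. Qed.

Lemma additive_funN (U V : zmodType) (f : U -> V) :
  {morph f : a b / a + b} -> {morph f : a / - a}.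
Proof.
move=> fD a; apply/eqP; rewrite -subr_eq0 opprK -fD addNr.
by rewrite (additive_fun0 fD).
Qed.

Let DNl x a : D (- x) a = - D x a.
Proof. exact: (additive_funN (f := D^~ a) (fun y z => ca_DDl ca y z a)). Qed.
Let DNr x a : D x (- a) = - D x a.
Proof. exact: (additive_funN (f := D x) (ca_DDr ca x)). Qed.
Let D0r x : D x 0 = 0.
Proof. exact: (additive_fun0 (f := D x) (ca_DDr ca x)). Qed.
Let D0l a : D 0 a = 0.
Proof. exact: (additive_fun0 (f := D^~ a) (fun y z => ca_DDl ca y z a)). Qed.
Let rhoN x : rho (- x) = - rho x.
Proof. exact: (additive_funN (ca_rhoD ca)). Qed.
Let gamN a : gam (- a) = - gam a.
Proof. exact: (additive_funN (ca_gamD ca)). Qed.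
Let gDr a b c : g a (b + c) = g a b + g a c.
Proof. by rewrite ca_gC // ca_gDl // -!(ca_gC ca a). Qed.
Let gNl a b : g (- a) b = - g a b.
Proof. exact: (additive_funN (f := g^~ b) (fun y z => ca_gDl ca y z b)). Qed.
Let g0l a : g 0 a = 0.
Proof. exact: (additive_fun0 (f := g^~ a) (fun y z => ca_gDl ca y z a)). Qed.
Let DB x a b : D x (a - b) = D x a - D x b.
Proof. by rewrite ca_DDr // DNr. Qed.

Lemma g_nondeg a b : (forall c, g a c = g b c) -> a = b.
Proof.
move=> h; apply/eqP; rewrite -subr_eq0; apply/eqP/(ca_g_eq0 ca).
by rewrite ca_gDl // gNl h addrN.
Qed.
Let evN i f : ev i (- f) = - ev i f.
Proof. exact: (additive_funN (f := ev i) (ca_evD ca i)). Qed.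
Let ev0 i : ev i 0 = 0.
Proof. exact: (additive_fun0 (f := ev i) (ca_evD ca i)). Qed.

(* Identities between additive expressions are checked on scalars. *)
Ltac fsolve := let i := fresh "i" in apply: (ca_ev_inj ca) => i;
  rewrite ?(ca_evD ca, evN, ev0); try lra.
Ltac esolve := let w := fresh "w" in apply: g_nondeg => w;
  rewrite ?(ca_gDl ca, gNl, g0l); fsolve.
Ltac fsolve_with e := let i := fresh "i" in apply: (ca_ev_inj ca) => i;
  move: (congr1 (ev i) e); rewrite ?(ca_evD ca, evN, ev0); try lra.
Ltac esolve_with e := let w := fresh "w" in let e' := fresh "e" in
  apply: g_nondeg => w; have e' := congr1 (g^~ w) e;
  rewrite /= ?(ca_gDl ca, gNl, g0l) in e'; rewrite ?(ca_gDl ca, gNl, g0l);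
  fsolve_with e'.

(** Comparing [ca_euler] with the metric condition for [g eta c], the terms [g a c] and those with
    [rho (br (gam a) (bet c))] match. There remains [g (mtor a eta) c + g eta (mtor a c) = 0], whose
    two summands agree by the symmetry of [mtor], so twice the first one vanishes. *)
Lemma mtor_eta a : mtor a eta = 0.
Proof.
apply: g_nondeg => c.
have := ca_euler ca a (bet c); rewrite ca_rho_bet // ca_metric //.
have h : g eta (mtor a c) = g (mtor a eta) c by rewrite ca_gC // /mtor -!lock ca_T.
have -> : D (gam a) eta = mtor a eta + a.
  by rewrite /mtor -!lock ca_br_gam_eta ?ca_rho_bet // subrK.
have -> : D (gam a) c = mtor a c + rho (br (gam a) (bet c)).
  by rewrite /mtor -!lock subrK.
rewrite ca_gDl // gDr h g0l => e; fsolve_with e.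
Qed.

Lemma D_gam_eta a : D (gam a) eta = a.
Proof.
have := mtor_eta a; rewrite /mtor -!lock ca_br_gam_eta ?ca_rho_bet // => /eqP.
by rewrite subr_eq0 => /eqP.
Qed.

(** [D _ eta] inverts the vertical lift and kills horizontal fields, so it reads off the vertical
    part. *)
Lemma field_split x : x = gam (D x eta) + bet (rho x).
Proof.
have [|a ha] := ca_ker_rho ca (x := x - bet (rho x)).
  by rewrite ca_rhoD // rhoN ca_rho_bet // subrr.
have -> : D x eta = a.
  rewrite -{1}[x](subrK (bet (rho x))) ha ca_DDl // D_gam_eta.
  by rewrite ca_D_bet_eta // addr0.
by rewrite -ha subrK.
Qed.

Let curvDl x x' y z : curv (x + x') y z = curv x y z + curv x' y z.
Proof. rewrite /curv -!lock !(ca_DDl ca, ca_DDr ca, ca_brDl ca); esolve. Qed.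
Let curvC x y z : curv x y z = - curv y x z.
Proof. rewrite /curv -!lock (ca_brC ca x y) DNl; esolve. Qed.
Let curvNl x y z : curv (- x) y z = - curv x y z.
Proof. exact: (additive_funN (f := fun t => curv t y z) (fun a b => curvDl a b y z)). Qed.
Let torDl x x' y : tor (x + x') y = tor x y + tor x' y.
Proof.
by rewrite /tor -!lock !(ca_DDl ca, ca_DDr ca, ca_brDl ca, ca_rhoD ca); esolve.
Qed.
Let torC x y : tor x y = - tor y x.
Proof. rewrite /tor -!lock (ca_brC ca x y) rhoN; esolve. Qed.
Let torDr x y y' : tor x (y + y') = tor x y + tor x y'.
Proof. rewrite torC torDl !(torC y) !(torC y'); esolve. Qed.
Let torNr x y : tor x (- y) = - tor x y.
Proof. exact: (additive_funN (f := tor x) (torDr x)). Qed.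

Lemma tor_gam_bet a b : tor (gam a) (bet b) = mtor a b.
Proof. by rewrite /tor /mtor -!lock ca_rho_gam // ca_rho_bet // D0r subr0. Qed.
Lemma tor_bet_bet a b : tor (bet a) (bet b) = 0.
Proof. by rewrite /tor -!lock !ca_rho_bet // ca_Q. Qed.
Lemma tor_gam_gam a b : tor (gam a) (gam b) = 0.
Proof. by rewrite /tor -!lock !ca_rho_gam // !D0r ca_br_gam // !subr0. Qed.

Lemma curv_metric_skew x y a b : g (curv x y a) b = - g (curv x y b) a.
Proof.
have := ca_act_br ca x y (g a b); rewrite !(ca_metric ca) !(ca_actDr ca).
rewrite !(ca_metric ca) /curv -!lock !(ca_gDl ca, gNl) => e; fsolve_with e.
rewrite !(ca_gC ca _ a) !(ca_gC ca (D _ a) (D _ b)); lra.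
Qed.

(** The second covariant derivatives on the right assemble into curvatures, the terms
    [D x (rho (br y z))] cancel, and the double brackets vanish by the projected Jacobi identity.
    The minus sign on the left comes from the sign convention of [curv]. *)
Lemma bianchi1 x y z :
  - (curv x y (rho z) + curv y z (rho x) + curv z x (rho y)) =
  D x (tor y z) + D y (tor z x) + D z (tor x y)
  + tor x (br y z) + tor y (br z x) + tor z (br x y).
Proof.
have := congr1 rho (ca_jacobi ca x y z).
rewrite !(ca_rhoD ca) (additive_fun0 (ca_rhoD ca)) => e.
rewrite /tor -!lock !(DB) /curv -!lock; esolve_with e.
Qed.

(** This is the Jacobi identity for commutators of the operators [D x]; the Jacobi identity of [br]
    disposes of [D] along double brackets. *)
Lemma bianchi2 x y z a :
  (D x (curv y z a) - curv y z (D x a)) + (D y (curv z x a) - curv z x (D y a))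
  + (D z (curv x y a) - curv x y (D z a)) =
  curv (br x y) z a + curv (br y z) x a + curv (br z x) y a.
Proof.
have := congr1 (D^~ a) (ca_jacobi ca x y z) => /=.
rewrite !(ca_DDl ca) D0l => e.
rewrite /curv -!lock !(ca_DDr ca, DNr).
rewrite (ca_brC ca (br x y)) (ca_brC ca (br y z)) (ca_brC ca (br z x)) !DNl.
esolve_with e.
Qed.

Let G := bet eta.

(** The horizontal part is the definition of [mtor]. The vertical part comes from evaluating
    [curv (bet z) (gam u)] on [eta], where [D (gam u) eta] is [u] and [D (bet z) eta] is zero. *)
Lemma br_gam_bet u z : br (gam u) (bet z) =
  bet (D (gam u) z - mtor u z) - gam (curv (bet z) (gam u) eta + D (bet z) u).
Proof.
rewrite {1}[br _ _]field_split addrC; congr (bet _ + _).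
  by rewrite /mtor -!lock opprB addrC subrK.
rewrite -gamN; congr gam.
rewrite /curv -!lock D_gam_eta ca_D_bet_eta // D0r (ca_brC ca (bet z)) DNl; esolve.
Qed.


Let mtorDl a b c : mtor (a + b) c = mtor a c + mtor b c.
Proof. by rewrite -!tor_gam_bet ca_gamD // torDl. Qed.
Let mtorDr a b c : mtor a (b + c) = mtor a b + mtor a c.
Proof. by rewrite -!tor_gam_bet ca_betD // torDr. Qed.
Let mtorNr a b : mtor a (- b) = - mtor a b.
Proof. exact: (additive_funN (f := mtor a) (mtorDr a)). Qed.
Let mtor_sym a b c : g (mtor a b) c = g (mtor a c) b.
Proof. by rewrite /mtor -!lock; exact: ca_T. Qed.
Let curv0 x y : curv x y 0 = 0.
Proof. by rewrite /curv -!lock !D0r oppr0 !addr0. Qed.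

(** The covariant derivative along [x] of the mixed torsion tensor. *)
Definition dmtor x u z := locked (D x (mtor u z) - mtor u (D x z) - mtor (D x u) z).

(** The first Bianchi identity for [bet x], [gam u], [bet z]. The purely horizontal curvature drops
    out, since it acts on [rho (gam u) = 0]. *)
Lemma hvcurvature_skew x u z :
  curv (bet x) (gam u) z - curv (bet z) (gam u) x =
  dmtor (bet z) u x - dmtor (bet x) u z
  - mtor (curv (bet z) (gam u) eta) x + mtor (curv (bet x) (gam u) eta) z.
Proof.
have := bianchi1 (bet x) (gam u) (bet z).
rewrite !ca_rho_bet // ca_rho_gam // (curvC (gam u)).
rewrite curv0 tor_bet_bet D0r tor_gam_bet (torC (bet x) (gam u)) tor_gam_bet DNr.
rewrite (ca_brC ca (bet x)) !br_gam_bet torNr.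
(* Only the horizontal part of this bracket contributes: its vertical part is paired in the torsion
   with [gam u], where [tor_gam_gam] gives zero. *)
have -> : br (bet z) (bet x) = gam (D (br (bet z) (bet x)) eta)
    + bet (D (bet z) x - D (bet x) z).
  rewrite {1}[br _ _]field_split; congr (_ + bet _).
  by have := ca_Q ca z x => /eqP; rewrite subr_eq0 => /eqP ->.
rewrite !torDr !torNr !tor_bet_bet tor_gam_gam tor_gam_bet mtorDr mtorNr.
rewrite !(torC (bet _) (gam _)) !tor_gam_bet !mtorDl /dmtor -!lock => e.
esolve_with e.
Qed.

Lemma dmtor_sym x u z w : g (dmtor x u z) w = g (dmtor x u w) z.
Proof.
have := congr1 (act x) (mtor_sym u z w).
rewrite !(ca_metric ca) /dmtor -!lock !(ca_gDl ca, gNl) => e.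
have e1 := mtor_sym (D x u) z w; have e2 := mtor_sym u (D x z) w.
have e3 := mtor_sym u (D x w) z.
rewrite e1 e2 e3; fsolve_with e.
Qed.

Lemma dmtor_eta a u : dmtor (bet a) u eta = 0.
Proof.
rewrite /dmtor -!lock !mtor_eta ca_D_bet_eta // D0r -tor_gam_bet.
by rewrite (additive_fun0 (ca_betD ca)) (additive_fun0 (torDr _)) !subrr.
Qed.

Lemma mtor_g_eta u z : g (mtor u z) eta = 0.
Proof. by rewrite mtor_sym mtor_eta g0l. Qed.

(** Skewness moves [eta] into the second slot of [g]. Pairing [hvcurvature_skew] with [eta] kills
    its right side, as all torsion terms there are g-symmetric and vanish on [eta]. *)
Lemma hvcurvature_eta_sym z u w :
  g (curv (bet z) (gam u) eta) w = g (curv (bet w) (gam u) eta) z.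
Proof.
rewrite (curv_metric_skew _ _ _ w) (curv_metric_skew _ _ _ z); congr (- _).
have := hvcurvature_skew z u w => /(congr1 (g^~ eta)) /=.
rewrite !(ca_gDl ca, gNl) !mtor_g_eta !(dmtor_sym _ _ _ eta) !dmtor_eta !g0l => e.
fsolve_with e.
Qed.

Lemma hvcurvature_eta u z : curv G (gam u) z = 0.
Proof.
apply: g_nondeg => w; rewrite g0l.
have e1 := congr1 (g^~ w) (hvcurvature_skew eta u z).
have e2 := congr1 (g^~ z) (hvcurvature_skew eta u w).
move: e1 e2; rewrite /= !mtor_eta !(ca_gDl ca, gNl) !dmtor_eta !g0l.
rewrite (hvcurvature_eta_sym z u w).
rewrite (dmtor_sym _ _ z) (mtor_sym _ z) (curv_metric_skew G _ z) => e1 e2.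
(* After the symmetries [e1] and [e2] differ only in the sign of this curvature term, so subtracting
   them leaves it twice. *)
have : g (curv G (gam u) w) z + g (curv G (gam u) w) z = 0.
  apply: (ca_ev_inj ca) => i; move: (congr1 (ev i) e1) (congr1 (ev i) e2).
  by rewrite ?(ca_evD ca, evN, ev0) /G; lra.
by move=> e; fsolve_with e.
Qed.

Theorem covder_vcurvature u v z :
  D G (curv (gam u) (gam v) z) - curv (gam (D G u)) (gam v) z
  - curv (gam u) (gam (D G v)) z - curv (gam u) (gam v) (D G z) =
  curv (bet v) (gam u) z - curv (bet u) (gam v) z.
Proof.
have := bianchi2 G (gam u) (gam v) z.
(* The bracket of two vertical fields is vertical, so its curvature term against [G] is again of the
   form [P(eta, _)] and vanishes. *)
have brgg : br (gam u) (gam v) = gam (D (br (gam u) (gam v)) eta).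
  by rewrite {1}[br _ _]field_split ca_br_gam // (additive_fun0 (ca_betD ca)) addr0.
have brgG a : br (gam a) G = bet a - gam (D G a).
  rewrite br_gam_bet hvcurvature_eta mtor_eta add0r subr0.
  by rewrite D_gam_eta.
rewrite !(curvC _ G) !hvcurvature_eta !DNr !D0r brgg hvcurvature_eta (ca_brC ca G) !brgG.
rewrite opprB !(curvDl, curvNl) (curvC (gam (D G v))) => e.
esolve_with e.
Qed.
End Algebraic.

(** * Additivity of derivations and brackets; subgroups as additive types *)

Section LieAdditive.
Variables (R : realType) (m : nat) (N : Type) (B : atlas R m N).
Hypothesis hB : manifold_atlas B.
Implicit Types (X Y Z : N -> 'rV[R]_m).

Lemma fderivDl X Y (f : N -> R) p :
  fderiv B (X \+ Y) f p = fderiv B X f p + fderiv B Y f p.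
Proof. by rewrite !fderivE difDr. Qed.

Lemma fderivDr X (f h : N -> R) p : smooth B f -> smooth B h ->
  fderiv B X (fun q => f q + h q) p = fderiv B X f p + fderiv B X h p.
Proof.
move=> sf sh; have kp := atlas_chart_at hB p.
rewrite !fderivE; set k := chart_at B p in kp *.
have df := smooth_dable sf kp; have dh := smooth_dable sh kp.
rewrite -(difD _ df dh); apply/esym/dif_near; last exact: dableD.
by apply: filterS (nbhs_chart hB kp) => _ [q kq ->]; rewrite !localrepE.
Qed.

Lemma lieDl X Y Z p : smooth_field B X -> smooth_field B Y ->
  lie B (X \+ Y) Z p = lie B X Z p + lie B Y Z p.
Proof.
move=> sX sY; have kp := atlas_chart_at hB p.
rewrite !(lie_at hB) !lbrE; set k := chart_at B p in kp *.
have locD q : cdom k q ->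
    locfield k X (cmap k q) + locfield k Y (cmap k q) = locfield k (X \+ Y) (cmap k q).
  move=> kq; rewrite !(locfieldE hB) //.
  by have := tcoord_linear k q 1 (X q) (Y q); rewrite !scale1r => ->.
have dX := field_dable sX kp; have dY := field_dable sY kp.
rewrite -(locD _ kp) difDr -(dif_near (f := fun y => locfield k X y + locfield k Y y)
  (g := locfield k (X \+ Y))).
- by rewrite (difD _ dX dY) opprD addrACA.
- by apply: filterS (nbhs_chart hB kp) => _ [q kq ->]; exact: locD.
- exact: dableD.
Qed.
End LieAdditive.

(** The closure proof is a parameter of the type, so that the group structure built from it can be
    attached as a canonical instance. *)
Definition subzmod (V : zmodType) (P : {pred V}) (cP : zmod_closed P) : Type :=
  {x : V | x \in P}.

Section SubZmodule.
Variables (V : zmodType) (P : {pred V}) (cP : zmod_closed P).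
Let S := subzmod cP.
HB.instance Definition _ := Choice.copy (subzmod cP) {x : V | x \in P}.

Let P0 : 0 \in P. Proof. by case: cP. Qed.
Let PN x : x \in P -> - x \in P.
Proof. by case: cP => _ PB Px; rewrite -sub0r PB. Qed.
Let PD x y : x \in P -> y \in P -> x + y \in P.
Proof. by case: cP => _ PB Px Py; rewrite -[y]opprK PB // PN. Qed.

Let zero : S := exist _ 0 P0.
Let opp (x : S) : S := exist _ (- sval x) (PN (svalP x)).
Let add (x y : S) : S :=
  exist _ (sval x + sval y) (PD (svalP x) (svalP y)).
Let addA : associative add.
Proof. by move=> x y z; apply: val_inj; exact: addrA. Qed.
Let addC : commutative add.
Proof. by move=> x y; apply: val_inj; exact: addrC. Qed.
Let add0 : left_id zero add.
Proof. by move=> x; apply: val_inj; exact: add0r. Qed.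
Let addN : left_inverse zero opp add.
Proof. by move=> x; apply: val_inj; exact: addNr. Qed.
HB.instance Definition _ := GRing.isZmodule.Build (subzmod cP) addA addC add0 addN.
End SubZmodule.

(** * The Cartan connection as a model of the additive laws *)

Section CartanConnection.
Variables (R : realType) (n : nat) (M : Type) (A : atlas R n M).
Hypothesis hA : manifold_atlas A.
Variable L : M * 'rV[R]_n -> R.
Hypothesis hL : finsler A L.
Variable D : vfield R n M -> pifield R n M -> pifield R n M.
Hypothesis hD : cartan_connection A D L.
Notation slit := (slit R n M).
Notation SA := (slit_atlas A).
Let hS := slit_manifold_atlas hA.
Let hC := cartan_linear hD.

Let PX : {pred slit -> 'rV[R]_(n + n)} := fun X => `[< smooth_field SA X >].
Let PE : {pred slit -> 'rV[R]_n} := fun X => `[< smooth_pifield A X >].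
Let PF : {pred slit -> R} := fun f => `[< smooth SA f >].

Let cX : zmod_closed PX.
Proof.
split; first exact/asboolP/(smooth_field0 hA).
move=> X Y /asboolP sX /asboolP sY; apply/asboolP/(smooth_fieldD hA) => //.
exact: smooth_fieldN.
Qed.
Let cE : zmod_closed PE.
Proof.
split; first exact/asboolP/(smooth_pifield0 hA).
move=> X Y /asboolP sX /asboolP sY; apply/asboolP/(smooth_pifieldD hA) => //.
exact: smooth_pifieldN.
Qed.
Let cF : zmod_closed PF.
Proof.
split; first exact/asboolP/(smooth_cst hS).
move=> f h /asboolP sf /asboolP sh; apply/asboolP/(smoothD hS) => //.
apply: smooth_ext (smoothM hS (smooth_cst hS (-1)) sh) => p.
by rewrite mulN1r.
Qed.

Let FX := subzmod cX.
Let FE := subzmod cE.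
Let FF := subzmod cF.
Let sX (x : FX) : smooth_field SA (sval x) := asboolW (svalP x).
Let sE (a : FE) : smooth_pifield A (sval a) := asboolW (svalP a).
Let sF (f : FF) : smooth SA (sval f) := asboolW (svalP f).
Let mkX X (s : smooth_field SA X) : FX := exist _ X (asboolT s).
Let mkE X (s : smooth_pifield A X) : FE := exist _ X (asboolT s).
Let mkF f (s : smooth SA f) : FF := exist _ f (asboolT s).

Let brS (x y : FX) : FX := mkX (smooth_lie hS (sX x) (sX y)).
Let DS (x : FX) (a : FE) : FE := mkE (connection_smooth hC (sX x) (sE a)).
Let actS (x : FX) (f : FF) : FF := mkF (smooth_fderiv hS (sX x) (sF f)).
Let rhoS (x : FX) : FE := mkE (smooth_rho hA (sX x)).
Let gamS (a : FE) : FX := mkX (smooth_gamma hA (sE a)).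
Let betS (a : FE) : FX := mkX (smooth_beta hA hL hD (sE a)).
Let gS (a b : FE) : FF := mkF (smooth_metric hA hL (sE a) (sE b)).
Let etaS : FE := mkE (smooth_eta hA).
Let evS (u : slit) (f : FF) : R := sval f u.

Let val_eq (T : Type) (V : zmodType) (P : {pred T -> V}) (cP : zmod_closed P)
  (x y : subzmod cP) : (forall u, sval x u = sval y u) -> x = y.
Proof. by move=> e; apply/val_inj/funext. Qed.

Let mDl u w : forall v v' : 'rV[R]_n,
  metric L u (v + v') w = metric L u v w + metric L u v' w.
Proof.
by move=> v v'; have := metric_linear hA hL u w 1 v v'; rewrite !scale1r.
Qed.

(** Equality of smooth fields is tested at each [u], which reduces every law to a pointwise fact.
    Evaluation at the points of the slit bundle is the separating family [ev]. *)
Lemma smooth_cartan_algebra :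
  cartan_algebra evS brS DS actS rhoS gamS betS gS etaS.
Proof.
split.
- by move=> x y z; apply: val_eq => u; exact: (lieDl hS _ _ (sX x) (sX y)).
- by move=> x y; apply: val_eq => u; exact: lieC.
- move=> x y z; apply: val_eq => u.
  exact: (lie_jacobi hS _ (sX x) (sX y) (sX z)).
- move=> x y a; apply: val_eq => u.
  by have := connection_addl hC (sX x) (sX y) (sE a) => /(congr1 (@^~ u)).
- move=> x a b; apply: val_eq => u.
  by have := connection_addr hC (sX x) (sE a) (sE b) => /(congr1 (@^~ u)).
- by move=> x y f; apply: val_eq => u; exact: fderivDl.
- by move=> x f h; apply: val_eq => u; exact: (fderivDr hS _ _ (sF f) (sF h)).
- move=> x y f; apply: val_eq => u.
  exact: (fderiv_lie hS _ (sX x) (sX y) (sF f)).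
- move=> x y; apply: val_eq => u.
  rewrite -[LHS]/(rho A (sval x \+ sval y) u).
  by rewrite -[RHS]/(rho A (sval x) u + rho A (sval y) u) !rhoE // linearD.
- move=> a b; apply: val_eq => u.
  rewrite -[LHS]/(gamma A (sval a \+ sval b) u).
  rewrite -[RHS]/(gamma A (sval a) u + gamma A (sval b) u) !gammaE //.
  by rewrite add_row_mx addr0.
- by move=> a b; apply: val_eq => u; exact: (betaD hA hD).
- move=> a; apply: val_eq => u.
  rewrite -[LHS]/(rho A (gamma A (sval a)) u) rhoE // gammaE //.
  by rewrite row_mxKl.
- by move=> a; apply: val_eq => u; rewrite /= (rho_beta hA hD).
- move=> x /(congr1 sval) x0.
  have [u|V sV e] := vertical_field hA (sX x); first by rewrite -[LHS]/(sval (rhoS x) u) x0.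
  by exists (mkE sV); apply: val_eq => u; rewrite e.
- by move=> a; apply: val_eq => u; exact: (Kmap_beta hA hL hD u (sE a)).
- move=> a b; apply: val_eq => u.
  exact: (rho_lie_gamma_gamma hA u (sE a) (sE b)).
- move=> a x /(congr1 sval) e; apply: val_eq => u.
  exact: (rho_lie_gamma_eta hA u (sE a) (sX x) e).
- by move=> a b c; apply: val_eq => u; exact: mDl.
- by move=> a b; apply: val_eq => u; exact: (metricC hA hL).
- move=> a a0; apply: val_eq => u; apply/eqP/negP => /negP au.
  have := finsler_posdef hL u au.
  by rewrite -[metric _ _ _ _]/(sval (gS a a) u) a0 ltxx.
- by [].
- by move=> f h e; apply: val_eq => u; exact: e.
- move=> x a b; apply: val_eq => u.
  exact: (cartan_metric hD (sX x) (sE a) (sE b) u).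
- move=> a b; apply: val_eq => u.
  have := cartan_Q hD (sE a) (sE b) u.
  by rewrite /Qtorsion /torsion !(rho_beta hA hD).
- move=> a b c; apply: val_eq => u.
  have := cartan_T hD (sE a) (sE b) (sE c) u.
  rewrite /Ttorsion /torsion !(rho_beta hA hD).
  (* [cartan_T] uses the full torsion. Its middle term differentiates [rho (gamma a) = 0], and once
     it is gone the form required by [ca_T] remains. *)
  have -> : rho A (gamma A (sval a)) = fun=> 0.
    by apply/funext => q; rewrite rhoE // gammaE // row_mxKl.
  rewrite !(connection0r hA hD) ?subr0; [exact|exact: (smooth_beta hA hL hD (sE c))|].
  exact: (smooth_beta hA hL hD (sE b)).
- by move=> a x; apply: val_eq => u; exact: (euler_identity hA hL u (sE a) (sX x)).
Qed.

Lemma covder_Scurv U V Z u :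
  smooth_pifield A U -> smooth_pifield A V -> smooth_pifield A Z ->
  covder D (beta A D (@eta R n M)) (Scurv A D) U V Z u =
  Pcurv A D V U Z u - Pcurv A D U V Z u.
Proof.
move=> sU sV sZ.
have := covder_vcurvature smooth_cartan_algebra (mkE sU) (mkE sV) (mkE sZ).
move=> /(congr1 (fun a : FE => sval a u)).
(* Once [curv] is unsealed, the underlying functions of the subtype operations are the concrete ones
   by conversion, so the abstract identity is already the goal. *)
rewrite /curv -!lock; exact.
Qed.
End CartanConnection.

Theorem theorem3p22 (R : realType) (n : nat) (M : topologicalType)
    (A : atlas R n M) (hM : smooth_manifold A)
    (L : M * 'rV[R]_n -> R) (hL : finsler A L)
    (D : vfield R n M -> pifield R n M -> pifield R n M)
    (hD : cartan_connection A D L) :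
  P_symmetric A D <->
  (forall X Y Z : pifield R n M,
     smooth_pifield A X -> smooth_pifield A Y -> smooth_pifield A Z ->
     forall u, covder D (beta A D (@eta R n M)) (Scurv A D) X Y Z u = 0).
Proof.
have key := covder_Scurv (smooth_manifold_atlas hM) hL hD.
split=> [hP X Y Z sX sY sZ u|hS X Y Z sX sY sZ u].
  by rewrite key // (hP Y X) // subrr.
by apply/eqP; rewrite -subr_eq0 -key // hS.
Qed.
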